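(* There is a polynomial $p$ such that for every $n\ge 2$ and every choice of guard functions $r,s$ (as in the context), the guarded graph tautology formula $\mathrm{GGT}_n$ has a greedy, unit-propagating, tree-like, regular w-resolution refutation with input lemmas having at most $p(n)$ clauses.
   Context: A w-resolution inference, from clauses $A$ and $B$ and a variable $x$ with $\overline x\notin A$ and $x\notin B$, derives $(A\setminus\{x\})\lor(B\setminus\{\overline x\})$ (the literal $x$ need not occur in $A$, nor $\overline x$ in $B$). A tree-like regular w-resolution refutation with input lemmas (regWRTI) of a set $\Gamma$ of clauses is a finite binary tree $R$ of clauses with the empty clause at the root, each internal node obtained by w-resolution from its two children, each root-to-leaf path resolving on each variable at most once, and each leaf being either a clause of $\Gamma$ or a clause derived earlier in postorder of $R$ by an input subderivation (one in which every inference has at least one hypothesis that is in $\Gamma$ or is such a lemma). (Postorder: for a node $u$, nodes $v$ in the left subtree and $w$ in the right subtree satisfy $v<w<u$.) For a clause $C$ in $R$, $C^+$ is the set of literals occurring in some clause on the branch from the root to $C$ inclusive, and $\Gamma(C)$ is $\Gamma$ together with every clause $D$ occurring before $C$ in postorder that has been derived by an input subproof. $R$ is greedy and unit-propagating if for every clause $C$ of $R$: whenever there is an input derivation from $\Gamma(C)$ of some clause $C'\subseteq C^+$ that does not resolve on any literal of $C^+$, then $C$ is derived in $R$ by such a derivation. Graph tautology formula: variables $x_{i,j}$ for $i<j$ in $[n]=\{0,\dots,n-1\}$, with $x_{i,j}$ for $i>j$ denoting $\overline x_{j,i}$; $T_{i,j,k}:=\overline x_{i,j}\lor\overline x_{j,k}\lor\overline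 x_{k,i}$. Let $r,s:[n]^3\to[n]$ satisfy, for distinct $i,j,k$: $r(i,j,k)\ne s(i,j,k)$, $\{r(i,j,k),s(i,j,k)\}\not\subseteq\{i,j,k\}$, and invariance under cyclic rotation of $(i,j,k)$. $\mathrm{GGT}_n$ consists of $\bigvee_{j\ne i}x_{j,i}$ for each $i\in[n]$ and, for distinct $i,j,k$ with $r=r(i,j,k)$, $s=s(i,j,k)$, the clauses $T_{i,j,k}\lor x_{r,s}$ and $T_{i,j,k}\lor\overline x_{r,s}$.
   Formalization: Γ(C) is taken to contain, besides Γ, only the input-derived clauses D before C in postorder that lie outside the subproof of C; read literally, with the clauses inside C's own subproof included, no greedy, unit-propagating refutation of this kind exists for n ≥ 4. *)

(* Defs.v *)
From mathcomp Require Import all_boot.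

Set Implicit Arguments.
Unset Strict Implicit.
Unset Printing Implicit Defensive.

(* The literal (x, true) is x, and (x, false) is its negation. *)
Definition literal (V : finType) : finType := (V * bool)%type.

Definition neg (V : finType) (l : literal V) : literal V := (l.1, ~~ l.2).

Definition clause (V : finType) : finType := {set literal V}.

(* The pivot of an inference is recorded as a literal [l] on the variable
   [l.1]: [l] is the literal removed from the left hypothesis and [neg l] the
   one removed from the right hypothesis. Both signs are needed because the
   order of the children matters for the postorder traversal. *)
Inductive wtree (V : finType) : Type :=
| Leaf of clause V
| Res of literal V & wtree V & wtree V.

Fixpoint concl (V : finType) (t : wtree V) : clause V :=
  match t with
  | Leaf C => C
  | Res l L R => (concl L :\ l) :|: (concl R :\ neg l)
  end.

Fixpoint wres_ok (V : finType) (t : wtree V) : bool :=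
  match t with
  | Leaf _ => true
  | Res l L R =>
      [&& neg l \notin concl L, l \notin concl R, wres_ok L & wres_ok R]
  end.

Fixpoint num_clauses (V : finType) (t : wtree V) : nat :=
  match t with
  | Leaf _ => 1
  | Res _ L R => (num_clauses L + num_clauses R).+1
  end.

Fixpoint leaves (V : finType) (t : wtree V) : seq (clause V) :=
  match t with
  | Leaf C => [:: C]
  | Res _ L R => leaves L ++ leaves R
  end.

Fixpoint pivots (V : finType) (t : wtree V) : seq V :=
  match t with
  | Leaf _ => [::]
  | Res l L R => l.1 :: pivots L ++ pivots R
  end.

Fixpoint regular (V : finType) (t : wtree V) : bool :=
  match t with
  | Leaf _ => true
  | Res l L R =>
      [&& l.1 \notin pivots L, l.1 \notin pivots R, regular L & regular R]
  end.

Definition is_leaf (V : finType) (t : wtree V) : bool :=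
  if t is Leaf _ then true else false.

(* The leaves of a derivation are its initial clauses and its lemmas, so a
   derivation is input when each inference has a leaf among its hypotheses. *)
Fixpoint input (V : finType) (t : wtree V) : bool :=
  match t with
  | Leaf _ => true
  | Res _ L R => [&& is_leaf L || is_leaf R, input L & input R]
  end.

(* A node is addressed by the path leading to it from the root: [false] goes
   to the left child and [true] to the right child. *)
Fixpoint subproof (V : finType) (t : wtree V) (p : seq bool) :
    option (wtree V) :=
  match p, t with
  | [::], _ => Some t
  | b :: p', Res _ L R => subproof (if b then R else L) p'
  | _ :: _, Leaf _ => None
  end.

Definition clause_at (V : finType) (t : wtree V) (p : seq bool) : clause V :=
  if subproof t p is Some s then concl s else set0.

Fixpoint postorder_lt (p q : seq bool) : bool :=
  match p, q with
  | [::], _ => false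
  | _ :: _, [::] => true
  | a :: p', b :: q' => if a == b then postorder_lt p' q' else ~~ a
  end.

Definition input_derived (V : finType) (t : wtree V) (q : seq bool)
    (D : clause V) : Prop :=
  exists2 s, subproof t q = Some s & input s /\ concl s = D.

Definition regWRTI_refutation (V : finType) (G : {set clause V})
    (R : wtree V) : Prop :=
  [/\ wres_ok R, concl R = set0, regular R &
      forall (p : seq bool) (C : clause V), subproof R p = Some (Leaf C) ->
        C \in G \/ exists2 q, postorder_lt q p & input_derived R q C].

(* The set C^+ for the clause C at the node [p]. *)
Definition branch_lits (V : finType) (R : wtree V) (p : seq bool) :
    {set literal V} :=
  \bigcup_(i < (size p).+1) clause_at R (take i p).

(* The set Gamma(C) for the clause C at the node [p]. These are the clauses
   available to a derivation of C, hence those learned before the traversal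
   enters the subproof of C. The descendants of [p] (addresses extending [p])
   also precede [p] in postorder, but they belong to the derivation of C.
   Including them would be degenerate: a clause resolved from two
   input-derived children would always be derivable from them in one step, so
   a greedy refutation would have to be an input refutation. *)
Definition available (V : finType) (G : {set clause V}) (R : wtree V)
    (p : seq bool) (D : clause V) : Prop :=
  D \in G \/
  exists q, [/\ postorder_lt q p, ~~ prefix p q & input_derived R q D].

Definition input_derivation_under (V : finType) (S : clause V -> Prop)
    (W : {set literal V}) (d : wtree V) : Prop :=
  [/\ wres_ok d, input d,
      forall D : clause V, D \in leaves d -> S D,
      concl d \subset W &
      forall x : V, x \in pivots d -> (x, true) \notin W /\ (x, false) \notin W].

Definition greedy_unit_propagating (V : finType) (G : {set clause V})
    (R : wtree V) : Prop :=
  forall (p : seq bool) (s : wtree V), subproof R p = Some s ->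
    (exists d, input_derivation_under (available G R p) (branch_lits R p) d) ->
    input_derivation_under (available G R p) (branch_lits R p) s.

Definition gtvar (n : nat) : finType :=
  {e : 'I_n * 'I_n | (e.1 < e.2)%N}.

(* The unit clause x_{i,j}: the variable (i, j) if i < j, and the negation of
   the variable (j, i) if i > j. In particular the negation of x_{i,j} is
   x_{j,i}. It is only used for i != j. *)
Definition xlit (n : nat) (i j : 'I_n) : clause (gtvar n) :=
  [set l : literal (gtvar n) | val l.1 == (if l.2 then (i, j) else (j, i))].

Lemma xlit_lt (n : nat) (i j : 'I_n) (h : (i < j)%N) :
  xlit i j = [set (exist _ (i, j) h : gtvar n, true)].
Proof.
apply/setP=> -[v []]; rewrite !inE /= xpair_eqE ?andbT ?andbF //.
by apply/eqP=> e; have := valP v; rewrite /= e /= ltnNge ltnW.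
Qed.

Lemma xlit_gt (n : nat) (i j : 'I_n) (h : (j < i)%N) :
  xlit i j = [set (exist _ (j, i) h : gtvar n, false)].
Proof.
apply/setP=> -[v []]; rewrite !inE /= xpair_eqE ?andbT ?andbF //.
by apply/eqP=> e; have := valP v; rewrite /= e /= ltnNge ltnW.
Qed.

Definition distinct3 (T : eqType) (i j k : T) : bool :=
  [&& i != j, j != k & k != i].

Definition guards (n : nat) (r s : 'I_n -> 'I_n -> 'I_n -> 'I_n) : Prop :=
  forall i j k : 'I_n, distinct3 i j k ->
    [/\ r i j k != s i j k,
        ~~ ([set r i j k; s i j k] \subset [set i; j; k]),
        r i j k = r j k i & s i j k = s j k i].

Definition vertex_clause (n : nat) (i : 'I_n) : clause (gtvar n) :=
  \bigcup_(j | j != i) xlit j i.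

(* The clause T_{i,j,k}; each negated x_{a,b} is written as x_{b,a}. *)
Definition triangle_clause (n : nat) (i j k : 'I_n) : clause (gtvar n) :=
  xlit j i :|: xlit k j :|: xlit i k.

Definition GGT (n : nat) (r s : 'I_n -> 'I_n -> 'I_n -> 'I_n) :
    {set clause (gtvar n)} :=
  [set C : clause (gtvar n) |
    [exists i, C == vertex_clause i] ||
    [exists i, exists j, exists k, distinct3 i j k &&
      ((C == triangle_clause i j k :|: xlit (r i j k) (s i j k)) ||
       (C == triangle_clause i j k :|: xlit (s i j k) (r i j k)))]].

(* Main.v *)
Require Import Defs.
From mathcomp Require Import all_boot all_order all_algebra.
From mathcomp Require Import zify.

(* A refutation is read as the trace of a DLL search in which [F] is the set of
   literals falsified by the current branch and [L] the set of clauses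
   available so far: below a node, either some input derivation from [L]
   falsifies [F] and one is used, or no such derivation exists and the search
   branches.

   The branch keeps a transitive tournament growing: at a state [(F, S, i)] all
   decided arcs lie inside [S] and [i] points to every other vertex of [S]. A
   new vertex [w] is inserted by deciding the arc between [i] and [w]. If [i]
   points to [w], then [i] is still a source. If [w] points to [i], the arcs
   between [w] and the rest of [S] are decided, each wrong choice closing a
   triangle at once, and [w] becomes the source. Both outcomes recurse, so the
   tree is small only if one of them is paid for: at the first closed triangle
   the derivation is enlarged so as to learn a new useful clause, and a
   potential counting the clauses still to be learned drops.

   The clauses learned first are the unguarded triangles, until each of them is
   learned, satisfied, or has a decided guard. A triangle with undecided guard
   which avoids [w] can be learned at a branch that has nothing to do with it,
   because literals absent from the branch are removed again by w-resolution
   with the available clause closing the branch. Then the remaining vertices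
   are put in a fixed order and the learned clauses say that a vertex [a] is
   not the source of the set reached after [m] insertions. Such a clause
   follows from the same one at [m + 1] for [a] and for the vertex inserted
   last, together with triangles. Once it is known for each remaining vertex at
   the time of its insertion, the rest of the search is a single chain. *)

Set Implicit Arguments.
Unset Strict Implicit.
Unset Printing Implicit Defensive.

(** * Search traces and their reading as greedy refutations *)

Section Search.
Variable V : finType.
Implicit Types (l : literal V) (C D B : clause V) (F E : {set literal V}).
Implicit Types (L : {set clause V}) (t d s A : wtree V) (p q : seq bool).

Lemma negK : involutive (@neg V).
Proof. by case=> v b; rewrite /neg /= negbK. Qed.

Lemma neg_neq l : neg l != l.
Proof. by case: l => v []; rewrite /neg /= xpair_eqE /= andbF. Qed.

Fixpoint learned t : {set clause V} :=
  match t with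
  | Leaf C => [set C]
  | Res l A B =>
      (if input t then [set concl t] else set0) :|: (learned A :|: learned B)
  end.

Lemma input_concl_learned t : input t -> concl t \in learned t.
Proof.
by case: t => [C|l A B] Hi; rewrite /= ?inE // ; move: Hi => /= ->; rewrite !inE eqxx.
Qed.

Lemma learnedP t D : reflect (exists q, input_derived t q D) (D \in learned t).
Proof.
elim: t => [C|l A IHA B IHB].
  apply: (iffP idP) => [|[[|b q] [s]]] //=.
    rewrite inE => /eqP ->; exists [::]; exists (Leaf C) => //.
  by case=> <- [_ <-]; rewrite inE.
have child (b : bool) : (exists q, input_derived (if b then B else A) q D) ->
    exists q, input_derived (Res l A B) q D.
  by case=> q Hq; exists (b :: q).
apply: (iffP idP) => [|[[|[] q] [s]]].
- move=> HD; have [Hi|/IHA|/IHB] : [\/ input (Res l A B) /\ concl (Res l A B) = D,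
    D \in learned A | D \in learned B].
  + move: HD; rewrite /learned -/learned; case: ifP => Hi; rewrite !inE /=.
      case/or3P=> [/eqP ->|HD|HD]; [exact: Or31|exact: Or32|exact: Or33].
    by case/orP=> HD; [exact: Or32|exact: Or33].
  + by exists [::]; exists (Res l A B).
  + exact: (child false).
  + exact: (child true).
- by case=> <- [Hi <-]; apply: input_concl_learned.
- move=> Hs HD; rewrite /= !inE; apply/orP; right; apply/orP; right.
  by apply/IHB; exists q; exists s.
- move=> Hs HD; rewrite /= !inE; apply/orP; right; apply/orP; left.
  by apply/IHA; exists q; exists s.
Qed.

(** [d] ranges over all input trees, whatever their pivots: the greedy condition forbids pivots only
    on [branch_lits], which may be smaller than the set [F] of literals decided along the branch. *)
Definition open F L : Prop :=
  forall d, input d -> {subset leaves d <= L} -> ~~ (concl d \subset F).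

(** Pivots are new to [F]: this yields regularity and, as conclusions lie in [F], the side
    conditions of w-resolution. The left subtree comes first in postorder, so what it learns is
    available on the right. *)
Fixpoint good F L t : Prop :=
  match t with
  | Leaf C => C \in L /\ C \subset F
  | Res l A B =>
      [/\ l \notin F, neg l \notin F, good (l |: F) L A,
          good (neg l |: F) (L :|: learned A) B &
          open F L \/ input t /\ {subset leaves t <= L}]
  end.

Lemma good_concl F L t : good F L t -> concl t \subset F.
Proof.
elim: t F L => [C|l A IHA B IHB] F L /=; first by case.
case=> _ _ /IHA HA /IHB HB _.
by rewrite subUset !subDset HA HB.
Qed.

Lemma good_wres F L t : good F L t -> wres_ok t.
Proof.
elim: t F L => [C|l A IHA B IHB] F L //= [lF nlF HA HB _].
rewrite (IHA _ _ HA) (IHB _ _ HB) !andbT; apply/andP; split.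
  apply: contra nlF => /(subsetP (good_concl HA)).
  by rewrite !inE (negPf (neg_neq l)).
apply: contra lF => /(subsetP (good_concl HB)).
by rewrite !inE eq_sym (negPf (neg_neq l)).
Qed.

Lemma good_pivots F L t x :
  good F L t -> x \in pivots t -> (x, true) \notin F /\ (x, false) \notin F.
Proof.
elim: t F L => [C|l A IHA B IHB] F L //= [lF nlF HA HB _].
rewrite inE mem_cat => /or3P[/eqP ->|xA|xB].
- by case: l lF nlF {HA HB} => v [] /=; rewrite /neg /=.
- by have [] := IHA _ _ HA xA; rewrite !inE !negb_or => /andP[_ ->] /andP[_ ->].
- by have [] := IHB _ _ HB xB; rewrite !inE !negb_or => /andP[_ ->] /andP[_ ->].
Qed.

Lemma good_regular F L t : good F L t -> regular t.
Proof.
elim: t F L => [C|l A IHA B IHB] F L //= [lF nlF HA HB _].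
rewrite (IHA _ _ HA) (IHB _ _ HB) !andbT; apply/andP; split; apply/negP.
  by move/(good_pivots HA); case: l {lF nlF HA HB} => v [] []; rewrite !inE eqxx.
by move/(good_pivots HB); case: l {lF nlF HA HB} => v [] []; rewrite !inE eqxx.
Qed.

Fixpoint avail_at L t p : {set clause V} :=
  match p, t with
  | b :: p', Res l A B =>
      if b then avail_at (L :|: learned A) B p' else avail_at L A p'
  | _, _ => L
  end.

Lemma avail_atP L t p s D : subproof t p = Some s ->
  reflect (D \in L \/
    exists q, [/\ postorder_lt q p, ~~ prefix p q & input_derived t q D])
  (D \in avail_at L t p).
Proof.
elim: p L t s => [|b p IH] L [C|l A B] s //= Hs.
- by apply: (iffP idP) => [|[//|[q [_ /negP[]]]]]; [left|rewrite prefix0s].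
- by apply: (iffP idP) => [|[//|[q [_ /negP[]]]]]; [left|rewrite prefix0s].
case: b Hs => Hs.
- apply: (iffP (IH _ _ _ Hs)).
    case=> [|[q [H1 H2 H3]]].
      rewrite inE => /orP[|/learnedP[q Hq]]; first by left.
      by right; exists (false :: q).
    by right; exists (true :: q); split.
  case=> [DL|[[|[] q] [//]]]; first by left; rewrite inE DL.
    by rewrite /= => H1 H2 H3; right; exists q.
  move=> _ _ Hq; left; rewrite inE; apply/orP; right.
  by apply/learnedP; exists q.
- apply: (iffP (IH _ _ _ Hs)) => -[|[q [H1 H2 H3]]]; try by left.
    by right; exists (false :: q); split.
  by case: q H1 H2 H3 => [|[] q] //= H1 H2 H3; right; exists q.
Qed.

(** [F'] collects the literals decided on the way to [p]. Each clause on the branch lies in the set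
    decided at its own node, hence in [F']. *)
Lemma good_at F L t p s : good F L t -> subproof t p = Some s ->
  exists F', [/\ F \subset F', good F' (avail_at L t p) s &
    forall i, clause_at t (take i p) \subset F'].
Proof.
elim: p F L t => [|b p IH] F L t Ht.
  have H0 : subproof t [::] = Some t by case: (t).
  rewrite H0 => -[<-]; exists F; split => // [|i]; first by case: t Ht {H0}.
  by rewrite /clause_at /= H0 (good_concl Ht).
have Hc := good_concl Ht.
case: t Ht Hc => [C|l A B] //= [_ _ HA HB _] Hc Hs.
suff [F' [sF' HF' Hi]] : exists F', [/\ F \subset F',
    good F' (if b then avail_at (L :|: learned A) B p else avail_at L A p) s
    & forall i, clause_at (if b then B else A) (take i p) \subset F'].
  exists F'; split=> // -[|i]; last exact: Hi.
  exact: subset_trans Hc sF'.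
have sub l' L' t' : good (l' |: F) L' t' -> subproof t' p = Some s ->
    exists F', [/\ F \subset F', good F' (avail_at L' t' p) s &
      forall i, clause_at t' (take i p) \subset F'].
  move=> H1 H2; have [F' [H3 H4 H5]] := IH _ _ _ H1 H2.
  by exists F'; split=> //; apply: subset_trans H3; apply: subsetUr.
by case: b Hs => Hs; apply: sub Hs; [exact: HB|exact: HA].
Qed.

Lemma available_availE G R p s D : subproof R p = Some s ->
  available G R p D <-> D \in avail_at G R p.
Proof. by move=> Hs; split => [/(avail_atP _ _ Hs)|/(avail_atP _ _ Hs)]. Qed.

(** A derivation permitted at [p] concludes inside [branch_lits], hence inside the decided set [F'].
    This contradicts [open], so the other alternative of [good] holds: the subtree at [p] is itself
    input with available leaves. *)
Lemma good_refutation G R : good set0 G R ->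
  regWRTI_refutation G R /\ greedy_unit_propagating G R.
Proof.
move=> HR; split.
  split; [exact: good_wres HR| |exact: good_regular HR|].
    by apply/eqP; rewrite -subset0 (good_concl HR).
  move=> p C Hs; have [F' [_ [HC _] _]] := good_at HR Hs.
  have [?|[q [? _ ?]]] := avail_atP _ _ Hs HC; first by left.
  by right; exists q.
move=> p s Hs [d [_ di dL dW _]].
have [F' [_ HF' Hi]] := good_at HR Hs.
have Hav D := available_availE G D Hs.
have sW : branch_lits R p \subset F' by apply/bigcupsP => i _; apply: Hi.
have sc : concl s \subset branch_lits R p.
  have -> : concl s = clause_at R (take (Ordinal (ltnSn (size p))) p).
    by rewrite /clause_at take_size Hs.
  by apply: (bigcup_sup (Ordinal (ltnSn (size p)))).
have [si sL] : input s /\ {subset leaves s <= avail_at G R p}.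
  case: s Hs HF' Hav {sc} => [C|l A B] Hs HF' Hav.
    by split=> // D; rewrite inE => /eqP ->; case: HF'.
  case: HF' => _ _ _ _ [Ho|//].
  have : {subset leaves d <= avail_at G R p} by move=> D /dL /Hav.
  by move/(Ho d di); rewrite (subset_trans dW sW).
split=> //; first exact: good_wres HF'.
- by move=> D /sL /Hav.
- move=> x /(good_pivots HF') [H1 H2].
  by split; [apply: contra H1|apply: contra H2] => /(subsetP sW).
Qed.
End Search.

(** * Unit propagation and closing derivations *)

Section Closing.
Variable V : finType.
Implicit Types (l : literal V) (C D B : clause V) (F E : {set literal V}).
Implicit Types (L : {set clause V}) (t d s A : wtree V) (p q : seq bool).

Definition consistent F := forall l, l \in F -> neg l \notin F.

Definition closing F L t :=
  [/\ good F L t, input t & {subset leaves t <= L}].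

Lemma closing_leaf F L C : C \in L -> C \subset F -> closing F L (Leaf C).
Proof. by move=> CL CF; split=> // D; rewrite inE => /eqP ->. Qed.

Lemma closing_Leaf_Res F L l B t : l \notin F -> neg l \notin F ->
  B \in L -> B \subset l |: F -> closing (neg l |: F) L t ->
  closing F L (Res l (Leaf B) t).
Proof.
move=> lF nlF BL BF [Ht ti tL].
have LB : L :|: learned (Leaf B) = L by apply/setUidPl; rewrite sub1set.
have sL : {subset leaves (Res l (Leaf B) t) <= L}.
  by move=> D; rewrite inE => /predU1P[->|/tL].
by split=> //; split=> //; [rewrite LB|right; split].
Qed.

Lemma closing_Res_Leaf F L l B t : l \notin F -> neg l \notin F ->
  B \in L -> B \subset neg l |: F -> closing (l |: F) L t ->
  closing F L (Res l t (Leaf B)).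
Proof.
move=> lF nlF BL BF [Ht ti tL].
have si : input (Res l t (Leaf B)) by rewrite /= orbT ti.
have sL : {subset leaves (Res l t (Leaf B)) <= L}.
  by move=> D; rewrite mem_cat inE => /orP[/tL|/eqP ->].
by split=> //; split=> //; [split=> //; rewrite inE BL|right; split].
Qed.

Lemma card_undecided F l : l \notin F -> #|~: (l |: F)| < #|~: F|.
Proof.
move=> lF; apply: proper_card; apply/properP; split.
  by rewrite setCS subsetUr.
by exists l; rewrite !inE ?eqxx.
Qed.

(** Each inference has a leaf as one child and decides one more literal for the other, so the tree
    is a path no longer than the number of undecided literals. *)
Lemma good_input_size F L t : good F L t -> input t ->
  num_clauses t <= 2 * #|~: F| + 1.
Proof.
elim: t F L => [C|l A IHA B IHB] F L /=; first by rewrite addn1.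
case=> lF nlF HA HB _ /and3P[AB Ai Bi].
have cA := IHA _ _ HA Ai; have cB := IHB _ _ HB Bi.
have := card_undecided lF; have := card_undecided nlF.
move: #|~: (l |: F)| #|~: (neg l |: F)| #|~: F| cA cB => a b c cA cB.
by case/orP: AB; [case: (A) cA|case: (B) cB] => //=; lia.
Qed.

Definition maxsize := 2 * #|{: literal V}| + 1.

Lemma closing_size F L t : closing F L t -> num_clauses t <= maxsize.
Proof.
case=> H1 H2 _; apply: leq_trans (good_input_size H1 H2) _.
by rewrite /maxsize leq_add2r leq_mul2l max_card.
Qed.

(** Unit propagation is stuck at [F]. If the pivot of the last inference is decided, one hypothesis
    would already lie in [F]; otherwise the leaf hypothesis would be a unit clause with an undecided
    literal. *)
Lemma stuck_open F L :
  (forall B, B \in L -> ~~ (B \subset F)) ->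
  (forall B l, B \in L -> B \subset l |: F -> l \notin F -> neg l \in F) ->
  open F L.
Proof.
move=> H0 H1; elim=> [C _ CL|l A IHA B IHB] /=; first by apply: H0 (CL C _); rewrite inE.
case/and3P=> AB Ai Bi sL; apply/negP; rewrite subUset !subDset => /andP[cA cB].
have sA : {subset leaves A <= L} by move=> D HD; apply: sL; rewrite mem_cat HD.
have sB : {subset leaves B <= L} by move=> D HD; apply: sL; rewrite mem_cat HD orbT.
have {}IHA := IHA Ai sA; have {}IHB := IHB Bi sB.
have setU1_id l' : l' \in F -> l' |: F = F by move=> H; apply/setUidPr; rewrite sub1set.
have [lF|lF] := boolP (l \in F); first by rewrite setU1_id // (negPf IHA) in cA.
have [nlF|nlF] := boolP (neg l \in F); first by rewrite setU1_id // (negPf IHB) in cB.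
case/orP: AB => [iA|iB].
- have HA : concl A \in L by apply: sA; case: (A) iA => //= C _; rewrite inE.
  by rewrite (H1 _ _ HA cA lF) in nlF.
- have HB : concl B \in L by apply: sB; case: (B) iB => //= C _; rewrite inE.
  by have := H1 _ _ HB cB nlF; rewrite negK (negPf lF).
Qed.

(** Unit propagation run to its end: either a clause is falsified, and the propagating clauses
    assemble into an input tree, or it gets stuck at a larger set, whose openness passes down to
    [F]. *)
Lemma closing_or_open F L : (exists t, closing F L t) \/ open F L.
Proof.
have [m] := ubnP #|~: F|; elim: m F => // m IH F Hm.
have [/exists_inP[C CL CF]|/exists_inPn H0] := boolP [exists C in L, C \subset F].
  by left; exists (Leaf C); apply: closing_leaf.
pose u := [exists B in L, exists l, [&& B \subset l |: F, l \notin F & neg l \notin F]].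
have [/exists_inP[B BL /existsP[l /and3P[Bl lF nlF]]]|/exists_inPn H1] := boolP u.
  have [|[t Ht]|Ho] := IH (neg l |: F).
  - by apply: leq_trans (card_undecided nlF) _.
  - by left; exists (Res l (Leaf B) t); apply: closing_Leaf_Res.
  - right=> d di dL; apply: contra (Ho d di dL) => /subset_trans; apply.
    exact: subsetUr.
right; apply: stuck_open => // B l BL Bl lF.
by have /existsPn/(_ l) := H1 B BL; rewrite Bl lF /= negbK.
Qed.

(* Resolving with the available clause [C0], which contains neither the pivot
   nor its negation, deletes the literals of [E] one at a time. *)
Lemma closing_weaken F E L t C0 : consistent (E :|: F) -> closing (E :|: F) L t ->
  C0 \in L -> C0 \subset F ->
  exists2 t', closing F L t' & learned t \subset learned t'.
Proof.
have [m] := ubnP #|E :\: F|; elim: m F => // m IH F Hm cEF Ht C0L C0F.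
have [EF|/subsetPn[y yE yF]] := boolP (E \subset F).
  by exists t => //; rewrite (setUidPr EF) in Ht.
have nyF : neg y \notin F.
  by apply: contra (cEF y _) => [H|]; rewrite !inE ?H ?orbT // yE.
have EyF : E :|: (y |: F) = E :|: F.
  by apply/setP=> z; rewrite !inE; case: eqP => [->|//]; rewrite yE.
have [|||||t1 [H1 i1 L1] s1] := IH (y |: F); rewrite ?EyF //.
- rewrite ltnS in Hm; apply: leq_trans Hm; apply: proper_card; apply/properP; split.
    by rewrite setDS // subsetUr.
  by exists y; rewrite !inE ?eqxx ?yE ?yF.
- exact: subset_trans C0F (subsetUr _ _).
exists (Res y t1 (Leaf C0)).
  by apply: closing_Res_Leaf => //; apply: subset_trans C0F (subsetUr _ _).
by apply: subset_trans s1 _ => /=; rewrite setUCA subsetUl.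
Qed.
End Closing.

(** * Amortized size bounds *)

Section Amortized.
Variables (V : finType) (b : nat) (Phi : {set clause V} -> nat).
Hypothesis Phi_anti : forall L L' : {set clause V}, L \subset L' -> Phi L' <= Phi L.
Implicit Types (l : literal V) (F : {set literal V}) (L : {set clause V}).
Implicit Types (t : wtree V).

(* [c] bounds the size of a tree, where [b] is credited for each unit by which
   [Phi] drops; the amount [p] of that credit is left for other parts of the
   proof. *)
Definition solvable p c F L :=
  exists2 t, good F L t &
    num_clauses t + b * Phi (L :|: learned t) + p <= b * Phi L + c.

Lemma solvable_good F L t c : good F L t -> num_clauses t <= c ->
  solvable 0 c F L.
Proof.
move=> Ht tc; exists t => //; rewrite addn0 addnC leq_add //.
by rewrite leq_mul2l Phi_anti ?orbT // subsetUl.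
Qed.

Lemma solvable_closing F L t : closing F L t -> solvable 0 (maxsize V) F L.
Proof. by move=> Ht; case: (Ht) => Hg _ _; apply: solvable_good Hg (closing_size Ht). Qed.

Lemma solvable_paid F L t : closing F L t -> Phi (L :|: learned t) < Phi L ->
  solvable b (maxsize V) F L.
Proof.
move=> Ht ltP; case: (Ht) => Hg _ _; exists t => //.
have := closing_size Ht; have := leq_mul (leqnn b) ltP; rewrite mulnS; lia.
Qed.

(** The right subtree is required for every larger [L'], since what the left subtree learns is not
    fixed in advance. The drops of the potential telescope along the traversal, so the credits add
    up. *)
Lemma solvable_Res p p1 p2 c c1 c2 F L l :
  l \notin F -> neg l \notin F -> open F L -> solvable p1 c1 (l |: F) L ->
  (forall L', L \subset L' -> solvable p2 c2 (neg l |: F) L') ->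
  p + (c1 + c2).+1 <= p1 + p2 + c -> solvable p c F L.
Proof.
move=> lF nlF Ho [t1 g1 n1] H2 le.
have [t2 g2 n2] := H2 _ (subsetUl L (learned t1)).
exists (Res l t1 t2); first by split=> //; left.
have : Phi (L :|: learned (Res l t1 t2)) <= Phi (L :|: learned t1 :|: learned t2).
  by apply: Phi_anti; rewrite -setUA setUS // /= subsetUr.
move/(leq_mul (leqnn b)); set X := Phi (L :|: learned (Res _ _ _)) => leX /=.
move: n1 n2 leX; move: (b * _) (b * _) (b * _) (b * _) => *; lia.
Qed.

Lemma solvable_le p c c' F L : c <= c' -> solvable p c F L -> solvable p c' F L.
Proof. by move=> le [t Ht n1]; exists t => //; lia. Qed.

Lemma solvable_pay p c c' F L : c <= p + c' -> solvable p c F L -> solvable 0 c' F L.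
Proof. by move=> le [t Ht n1]; exists t => //; lia. Qed.

Lemma solvable_open c F L : maxsize V <= c -> (open F L -> solvable 0 c F L) ->
  solvable 0 c F L.
Proof.
move=> le H; have [[t Ht]|] := closing_or_open F L; last exact: H.
exact: solvable_le le (solvable_closing Ht).
Qed.

End Amortized.

(** * Literals as arcs of a tournament *)

Section Arcs.
Variable n : nat.
Implicit Types (l : literal (gtvar n)) (x y z w a : 'I_n) (S : {set 'I_n}).

Lemma consistentU1 (V : finType) (l : literal V) F :
  consistent F -> neg l \notin F -> consistent (l |: F).
Proof.
move=> cF nl l'; rewrite !inE => /predU1P[->|l'F].
  by rewrite negb_or nl neg_neq.
rewrite negb_or cF // andbT; apply: contra nl => /eqP <-.
by rewrite negK.
Qed.

(* The literal [l] asserts the edge from [(edge l).1] to [(edge l).2]. *)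
Definition edge l : 'I_n * 'I_n :=
  if l.2 then val l.1 else ((val l.1).2, (val l.1).1).

Lemma edge_neq l : (edge l).1 != (edge l).2.
Proof.
case: l => [[[i j] h] []]; rewrite /edge /=;
  by apply: contraTneq h => /= ->; rewrite ltnn.
Qed.

Lemma edge_neg l : edge (neg l) = ((edge l).2, (edge l).1).
Proof. by case: l => [[[i j] h] []]. Qed.

Lemma edge_inj : injective edge.
Proof.
move=> [[[i j] h] b] [[[i' j'] h'] b'] /=.
case: b; case: b'; rewrite /edge /= => -[*]; subst; rewrite ?(bool_irrelevance h h') //;
  by have := ltn_trans h h'; rewrite ltnn.
Qed.

Lemma in_xlit x y l : (l \in xlit x y) = (edge l == (x, y)).
Proof.
by case: l => [[[i j] h] []]; rewrite inE //= /edge /= !xpair_eqE andbC.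
Qed.

Variable l0 : literal (gtvar n).

Fact lit_subproof x y : {l | x != y -> edge l = (x, y)}.
Proof.
have [h|h|e] := ltngtP x y.
- by exists (exist _ (x, y) h, true).
- by exists (exist _ (y, x) h, false).
- by exists l0; rewrite (val_inj e) eqxx.
Qed.

(* The literal [x_{x,y}]; its value for [x = y] is irrelevant. *)
Definition lit x y := sval (lit_subproof x y).

Lemma edge_lit x y : x != y -> edge (lit x y) = (x, y).
Proof. exact: svalP (lit_subproof x y). Qed.

Lemma eq_lit x y l : x != y -> (l == lit x y) = (edge l == (x, y)).
Proof. by move=> xy; rewrite -(inj_eq edge_inj) edge_lit. Qed.

Lemma lit_eq x y a z : x != y -> a != z ->
  (lit x y == lit a z) = (x == a) && (y == z).
Proof. by move=> xy az; rewrite eq_lit // edge_lit. Qed.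

Lemma neg_lit x y : x != y -> neg (lit x y) = lit y x.
Proof.
by move=> xy; apply: edge_inj; rewrite edge_neg !edge_lit // eq_sym.
Qed.

Lemma xlitE x y : x != y -> xlit x y = [set lit x y].
Proof. by move=> xy; apply/setP=> l; rewrite in_xlit inE eq_lit. Qed.

(** The clause saying that [a] is not a source of [S]. It is falsified exactly when [a] points to
    every other vertex of [S]. *)
Definition star a (S : {set 'I_n}) : clause (gtvar n) :=
  [set l | ((edge l).2 == a) && ((edge l).1 \in S)].

Lemma vertex_clauseE a : vertex_clause a = star a setT.
Proof.
apply/setP=> l; rewrite !inE andbT; apply/bigcupP/idP.
  by case=> j ja; rewrite in_xlit => /eqP ->.
move=> /eqP <-; exists (edge l).1; first exact: edge_neq.
by rewrite in_xlit; case: (edge l).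
Qed.

Lemma starP a S (F : {set literal (gtvar n)}) :
  reflect (forall y, y \in S -> y != a -> lit y a \in F) (star a S \subset F).
Proof.
apply: (iffP subsetP) => [H y yS ya|H l].
  by apply: H; rewrite inE edge_lit //= eqxx.
rewrite inE => /andP[/eqP la lS].
have -> : l = lit (edge l).1 a.
  by apply/eqP; rewrite eq_lit -la ?edge_neq //; case: (edge l).
by apply: H => //; rewrite -la edge_neq.
Qed.

Lemma triangle_subP x y z (F : {set literal (gtvar n)}) : distinct3 x y z ->
  reflect [/\ lit y x \in F, lit z y \in F & lit x z \in F]
    (triangle_clause x y z \subset F).
Proof.
case/and3P=> xy yz zx; rewrite /triangle_clause !xlitE 1?eq_sym //.
by rewrite !subUset !sub1set -andbA; apply: and3P.
Qed.

Definition spans (S : {set 'I_n}) (F : {set literal (gtvar n)}) :=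
  forall l, l \in F -> (edge l).1 \in S /\ (edge l).2 \in S.

Lemma spans_notin S F x y : spans S F -> x != y ->
  (x \notin S) || (y \notin S) -> lit x y \notin F.
Proof.
move=> sF xy; rewrite -negb_and; apply: contra => /sF.
by rewrite edge_lit //= => -[-> ->].
Qed.

Lemma spansU1 S F x y : spans S F -> x != y -> x \in S -> y \in S ->
  spans S (lit x y |: F).
Proof. by move=> sF xy xS yS l; rewrite !inE => /predU1P[->|/sF//]; rewrite edge_lit. Qed.

Lemma spans_sub S S' F : S \subset S' -> spans S F -> spans S' F.
Proof. by move=> /subsetP sS sF l /sF[? ?]; split; apply: sS. Qed.

End Arcs.

(** The side clauses [B] are resolved one after another against [D]. Two sets are kept apart: pivots
    must be undecided in [F], while the conclusion must fit in the smaller [E], so that a short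
    clause can be learned deep in a branch. *)
Lemma closing_comb (V : finType) (ls : seq (literal V)) (E F : {set literal V})
    (L : {set clause V}) (D : clause V) :
  E \subset F -> uniq [seq l.1 | l <- ls] ->
  (forall l, l \in ls -> l \notin F /\ neg l \notin F) ->
  (forall l, l \in ls -> exists2 B, B \in L & B \subset l |: E) ->
  D \in L -> {in D, forall l, (l \in E) || (neg l \in ls)} ->
  exists2 t, closing F L t & concl t \subset E.
Proof.
elim: ls E F => [|l ls IH] E F EF.
  move=> _ _ _ DL DE; exists (Leaf D).
    apply: closing_leaf => //; apply/subsetP => l /DE; rewrite orbF.
    exact: (subsetP EF).
  by apply/subsetP => l /DE; rewrite orbF.
move=> /= /andP[lls uls] Hd HB DL DE.
have [lF nlF] := Hd l (mem_head _ _).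
have [B BL BE] := HB l (mem_head _ _).
have neq l' : l' \in ls -> l'.1 != l.1.
  by move=> H; apply: contraNneq lls => <-; apply: map_f.
have [|||||//|t Ht ct] := IH (neg l |: E) (neg l |: F); rewrite ?setUS //.
- move=> l' H; have [? ?] := Hd l' (mem_behead (s := l :: ls) H).
  rewrite !inE !negb_or; split; apply/andP; split=> //;
    apply: contra (neq _ H) => /eqP; first by move=> ->.
  by move/(congr1 fst) => /= ->.
- move=> l' H; have [B' ? s'] := HB l' (mem_behead (s := l :: ls) H).
  exists B' => //; apply: subset_trans s' _; apply: setUS; exact: subsetUr.
- move=> l' /DE; rewrite !inE => /orP[->|/orP[/eqP <-|->]]; rewrite ?orbT //.
  by rewrite negK eqxx.
exists (Res l (Leaf B) t).
  apply: closing_Leaf_Res => //; apply: subset_trans BE _; exact: setUS.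
by rewrite /= subUset !subDset BE ct.
Qed.

(** * Guarded triangles *)

Section Triangles.
Variables (n : nat) (r s : 'I_n -> 'I_n -> 'I_n -> 'I_n).
Hypothesis rs_guards : guards r s.
Variable l0 : literal (gtvar n).
Local Notation lit := (lit l0).
Implicit Types (x y z w a i : 'I_n) (S : {set 'I_n}).
Implicit Types (F : {set literal (gtvar n)}) (L : {set clause (gtvar n)}).

Definition guard x y z := lit (r x y z) (s x y z).

Lemma guard_GGT x y z : distinct3 x y z ->
  triangle_clause x y z :|: [set guard x y z] \in GGT r s.
Proof.
move=> d; have [rs _ _ _] := rs_guards d.
rewrite inE; apply/orP; right; apply/existsP; exists x; apply/existsP; exists y.
by apply/existsP; exists z; rewrite d /guard -xlitE // eqxx.
Qed.

Lemma nguard_GGT x y z : distinct3 x y z ->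
  triangle_clause x y z :|: [set neg (guard x y z)] \in GGT r s.
Proof.
move=> d; have [rs _ _ _] := rs_guards d.
rewrite inE; apply/orP; right; apply/existsP; exists x; apply/existsP; exists y.
apply/existsP; exists z; rewrite d /guard neg_lit //.
by rewrite -xlitE 1?eq_sym // eqxx orbT.
Qed.

Lemma vertex_GGT a : star a setT \in GGT r s.
Proof. by rewrite -vertex_clauseE inE; apply/orP; left; apply/existsP; exists a. Qed.

Definition decided F (l : literal (gtvar n)) := (l \in F) || (neg l \in F).

(** Once the guard is decided, one of the two guarded clauses has its guard literal falsified by
    [F], so the triangle can be used as if it were a clause. *)
Lemma guard_leaf F L x y z : GGT r s \subset L -> distinct3 x y z ->
  (triangle_clause x y z \in L) || decided F (guard x y z) ->
  exists2 C, C \in L & C \subset F :|: triangle_clause x y z.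
Proof.
move=> /subsetP GL d; case/or3P=> H.
- by exists (triangle_clause x y z) => //; apply: subsetUr.
- exists (triangle_clause x y z :|: [set guard x y z]).
    by apply/GL/guard_GGT.
  by rewrite setUC setSU // sub1set.
- exists (triangle_clause x y z :|: [set neg (guard x y z)]).
    by apply/GL/nguard_GGT.
  by rewrite setUC setSU // sub1set.
Qed.

(** Resolving the two guarded clauses on their guard yields exactly the triangle. *)
Lemma closing_guard F L x y z : GGT r s \subset L -> distinct3 x y z ->
  triangle_clause x y z \subset F -> ~~ decided F (guard x y z) ->
  exists2 t, closing F L t & triangle_clause x y z \in learned t.
Proof.
move=> /subsetP GL d TF; rewrite negb_or => /andP[gF ngF].
set T := triangle_clause x y z; set g := guard x y z.
have gT : g \notin T by apply: contra gF; apply: (subsetP TF).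
have ngT : neg g \notin T by apply: contra ngF; apply: (subsetP TF).
exists (Res g (Leaf (T :|: [set g])) (Leaf (T :|: [set neg g]))).
  apply: closing_Leaf_Res => //; first by apply/GL/guard_GGT.
    by rewrite setUC setUS.
  apply: closing_leaf; first by apply/GL/nguard_GGT.
  by rewrite setUC setUS.
set t := Res _ _ _; have <- : concl t = T; last exact: input_concl_learned.
by rewrite /= ![T :|: _]setUC !setU1K // setUid.
Qed.

Lemma closing_triangle F L x y z : GGT r s \subset L -> distinct3 x y z ->
  triangle_clause x y z \subset F -> exists t, closing F L t.
Proof.
move=> GL d TF; have [H|H] := boolP (decided F (guard x y z)).
  have [|C CL] := @guard_leaf F L _ _ _ GL d; first by rewrite H orbT.
  rewrite (setUidPl TF) => CF; exists (Leaf C); exact: closing_leaf.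
by have [t] := closing_guard GL d TF H; exists t.
Qed.

(* Literals of [F] are false: [lit y i \in F] directs the edge from [i] to [y]. *)
Definition source_of F S i :=
  [/\ consistent F, spans S F, i \in S & star i S \subset F].
End Triangles.

(** * Inserting a vertex into the tournament *)

Section Insertion.
Variables (n : nat) (r s : 'I_n -> 'I_n -> 'I_n -> 'I_n).
Hypothesis rs_guards : guards r s.
Variable l0 : literal (gtvar n).
Local Notation lit := (lit l0).
Implicit Types (x y z w a i : 'I_n) (S : {set 'I_n}).
Implicit Types (F H : {set literal (gtvar n)}) (L : {set clause (gtvar n)}).

Lemma source_of_insert F S i w : source_of F S i -> w \notin S ->
  source_of (lit w i |: F) (w |: S) i.
Proof.
move=> [cF sF iS star_i] wS.
have wi : w != i by apply: contraNneq wS => ->.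
split.
- by apply: consistentU1; rewrite // neg_lit // (spans_notin _ sF) 1?eq_sym // wS orbT.
- apply: spansU1 => //; rewrite ?inE ?eqxx ?iS ?orbT //.
  exact: spans_sub (subsetUr _ _) sF.
- by rewrite inE iS orbT.
- apply/(starP l0) => y; rewrite !inE => /predU1P[->|yS] yi; first by rewrite eqxx.
  by rewrite (starP l0 _ _ _ star_i) ?orbT.
Qed.

Variables (b : nat) (Phi : {set clause (gtvar n)} -> nat).
Hypothesis Phi_anti :
  forall L L' : {set clause (gtvar n)}, L \subset L' -> Phi L' <= Phi L.
Local Notation solvable := (solvable b Phi).
Local Notation K := (maxsize (gtvar n)).

Section Step.
Variables (F : {set literal (gtvar n)}) (L : {set clause (gtvar n)}).
Variables (S : {set 'I_n}) (i w : 'I_n) (c : nat).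
Hypothesis GL : GGT r s \subset L.
Hypothesis iF : source_of F S i.
Hypothesis wS : w \notin S.
Hypothesis Kc : K <= c.
Hypothesis rec : forall i' F' L', i' = i \/ i' = w -> F \subset F' ->
  L \subset L' -> source_of F' (w |: S) i' -> solvable 0 c F' L'.

Let iS : i \in S. Proof. by case: iF. Qed.
Let wi : w != i. Proof. by apply: contraNneq wS => ->. Qed.
Let neq_w y : y \in S -> w != y.
Proof. by move=> yS; apply: contraNneq wS => ->. Qed.

(** Here [w] points to [i]. For [y] in [ys], letting [y] point to [w] closes the cycle [i], [y], [w]
    with at most [K] clauses, so the search goes on with [w] pointing to [y]. When [ys] is
    exhausted, [w] is the source. *)
Lemma completions ys F' L' : F \subset F' -> L \subset L' ->
  consistent F' -> spans (w |: S) F' -> lit i w \in F' ->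
  {subset ys <= S} -> (forall y, y \in S -> lit y w \in F' \/ y \in ys) ->
  solvable 0 (c + size ys * K.+1) F' L'.
Proof.
elim: ys F' L' => [|y ys IH] F' L' FF' LL' cF' sF' iwF' ysS Hys.
  rewrite addn0; apply: rec => //; [by right|split=> //; first by rewrite setU11].
  apply/(starP l0) => y; rewrite in_setU1 => /predU1P[->|/Hys[]//].
  by rewrite eqxx.
have yS : y \in S by apply: ysS; rewrite mem_head.
have sys : {subset ys <= S} by move=> z zs; apply: ysS; rewrite inE zs orbT.
have Kle m : K <= c + m by apply: leq_trans Kc (leq_addr _ _).
have wy := neq_w yS.
have [ywF'|ywF'] := boolP (lit y w \in F').
  apply: solvable_le (IH _ _ FF' LL' cF' sF' iwF' sys _).
    by rewrite leq_add2l leq_mul2r leqnSn orbT.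
  by move=> z /Hys[]; [left|rewrite inE => /predU1P[->|]; [left|right]].
have yi : y != i by apply: contraNneq ywF' => ->.
have GL' := subset_trans GL LL'.
have close F1 : F' \subset F1 -> lit w y \in F1 -> solvable 0 K F1 L'.
  move=> F'1 wyF1; have [||t Ht] := @closing_triangle _ _ _ rs_guards l0 F1 L' i y w GL'.
  - by rewrite /distinct3 eq_sym yi eq_sym wy wi.
  - apply/(triangle_subP l0); first by rewrite /distinct3 eq_sym yi eq_sym wy wi.
    split=> //; apply: (subsetP F'1) => //; apply: (subsetP FF').
    by case: iF => _ _ _ /(starP l0); apply.
  exact: solvable_closing Ht.
have [wyF'|wyF'] := boolP (lit w y \in F').
  by apply: solvable_le (close F' _ wyF').
apply: solvable_open => // Ho.
have H2 L2 : L' \subset L2 ->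
    solvable 0 (c + size ys * K.+1) (neg (lit w y) |: F') L2.
  move=> L'2; rewrite neg_lit //; apply: IH => //.
  - by apply: subset_trans FF' (subsetUr _ _).
  - exact: subset_trans LL' L'2.
  - by apply: consistentU1; rewrite // neg_lit // eq_sym.
  - by apply: spansU1; rewrite // ?inE ?eqxx ?yS ?orbT // eq_sym.
  - by rewrite in_setU1 iwF' orbT.
  - move=> z /Hys[zw|]; first by left; rewrite in_setU1 zw orbT.
    by rewrite inE => /predU1P[->|zs]; [left; rewrite setU11|right].
apply: (solvable_Res Phi_anti wyF' _ Ho _ H2); first by rewrite neg_lit.
  by apply: close; rewrite ?subsetUr ?setU11.
by rewrite /= mulSn; move: K (size ys) => k m; clear; lia.
Qed.

Lemma reversed_arc F' L' : lit i w |: F \subset F' -> L \subset L' -> consistent F' ->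
  spans (w |: S) F' -> solvable 0 (c + n * K.+1) F' L'.
Proof.
move=> FF' LL' cF' sF'.
have le : c + size (enum S) * K.+1 <= c + n * K.+1.
  by rewrite leq_add2l leq_mul2r -cardE -[X in _ <= X]card_ord max_card orbT.
apply: solvable_le le _; apply: completions => //.
- exact: subset_trans (subsetUr _ _) FF'.
- by apply: (subsetP FF'); rewrite setU11.
- by move=> y; rewrite mem_enum.
- by move=> y yS; right; rewrite mem_enum.
Qed.

Let F1 := lit i w |: F.

Let cF1 : consistent F1.
Proof.
case: iF => cF sF _ _; apply: consistentU1; rewrite // neg_lit 1?eq_sym //.
by rewrite (spans_notin _ sF) // wS.
Qed.

Let sF1 : spans (w |: S) F1.
Proof.
case: iF => _ sF _ _; apply: spansU1; rewrite ?inE ?eqxx ?iS ?orbT // 1?eq_sym //.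
exact: spans_sub (subsetUr _ _) sF.
Qed.

Let insert_aux c2 : solvable 0 c2 F1 L -> solvable 0 (c2 + c).+1 F L.
Proof.
move=> H1; case: (iF) => cF sF _ _.
apply: solvable_open => [//|//|Ho]; first by apply: leq_trans Kc _; lia.
have iw : i != w by rewrite eq_sym.
apply: (solvable_Res (l := lit i w) (p := 0) Phi_anti _ _ Ho H1 (c2 := c) (p2 := 0)).
- by rewrite (spans_notin _ sF) // wS orbT.
- by rewrite neg_lit // (spans_notin _ sF) // wS.
- move=> L' LL'; rewrite neg_lit //; apply: (rec (i' := i)) => //; first by left.
    exact: subsetUr.
  exact: source_of_insert.
- by lia.
Qed.

(** Both outcomes recurse at cost [c], so iterating this step alone doubles the bound at each
    insertion. *)
Lemma insert_unpaid : solvable 0 (c + n * K.+1 + c).+1 F L.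
Proof. by apply: insert_aux; apply: reversed_arc. Qed.

(** The cycle [i], [y], [w] is closed by [t], and the drop of [Phi] releases a credit [b] which
    covers the recursive call with source [w]. Only the call with source [i] remains in the bound,
    so iteration is additive. *)
Lemma insert_paid y : y \in S -> y != i -> c <= b ->
  (exists2 t, closing (lit w y |: F1) L t & Phi (L :|: learned t) < Phi L) ->
  solvable 0 (n.+1 * K.+1 + c).+1 F L.
Proof.
move=> yS yi cb [t Ht Pt]; apply: insert_aux; case: (iF) => cF sF _ _.
have wy := neq_w yS.
have [iw yw] : i != w /\ y != w by rewrite ![_ == w]eq_sym.
apply: solvable_open => [//|//|Ho]; first by rewrite mulSn; lia.
apply: (solvable_pay (p := b) (c := (K + (c + n * K.+1)).+1)).
  by rewrite mulSn; lia.
have yi' : (y == i) = false by apply: negPf.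
have und l : l = lit w y \/ l = lit y w -> l \notin F1.
  case=> ->; rewrite in_setU1 negb_or lit_eq // negb_and ?yi' ?(negPf wi) ?orbT /=.
    by rewrite (spans_notin _ sF) // wS.
  by rewrite (spans_notin _ sF) // wS orbT.
(* The drop caused by [t] is known relative to [L] itself, so its branch is visited first, before
   anything else is learned. *)
apply: (solvable_Res (l := lit w y) (p := b) Phi_anti _ _ Ho (solvable_paid b Ht Pt)
  (c2 := c + n * K.+1) (p2 := 0)).
- by apply: und; left.
- by rewrite neg_lit //; apply: und; right.
- move=> L' LL'; rewrite neg_lit //; apply: reversed_arc => //.
  + exact: subsetUr.
  + apply: consistentU1 => //; rewrite neg_lit //; by apply: und; left.
  + by apply: spansU1; rewrite // ?inE ?eqxx ?yS ?orbT.
- by lia.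
Qed.
End Step.
End Insertion.

(** The cost of unpaid insertions only, exponential in the number [u] of missing vertices. Only
    [u = 5] enters the final bound. *)
Fixpoint brute_bound (m K u : nat) : nat :=
  if u is u'.+1 then (brute_bound m K u' + m * K.+1 + brute_bound m K u').+1 else K.

Lemma other_member (T : finType) (A : {set T}) x : 1 < #|A| ->
  exists2 y, y \in A & y != x.
Proof.
case/card_gt1P=> y [z [yA zA yz]].
have [yx|yx] := eqVneq y x; last by exists y.
by exists z; rewrite // -yx eq_sym.
Qed.

Definition step_cost (m K : nat) := (m.+1 * K.+1).+1.

Definition chain_cost (m K : nat) := K + m * K.+1.

Definition ready_base (m K : nat) := (chain_cost m K + m * K.+1 + chain_cost m K).+1.

(** Bounds the second phase net of credits and also serves as its credit [b], so that each drop of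
    the potential can pay for a whole recursive call. *)
Definition ready_cost (m K : nat) := ready_base m K + m * step_cost m K.

(** * First phase: learning triangles *)

Section Phase1.
Variables (n : nat) (r s : 'I_n -> 'I_n -> 'I_n -> 'I_n).
Hypothesis rs_guards : guards r s.
Variable l0 : literal (gtvar n).
Local Notation lit := (lit l0).
Local Notation guard := (guard r s l0).
Implicit Types (x y z w a i : 'I_n) (S : {set 'I_n}).
Implicit Types (F H : {set literal (gtvar n)}) (L : {set clause (gtvar n)}).
Local Notation K := (maxsize (gtvar n)).

Lemma in_triangle x y z l : (l \in triangle_clause x y z) =
  [|| edge l == (y, x), edge l == (z, y) | edge l == (x, z)].
Proof. by rewrite /triangle_clause !in_setU !in_xlit orbA. Qed.

Lemma triangle_spans x y z : spans [set x; y; z] (triangle_clause x y z).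
Proof.
move=> l; rewrite in_triangle.
by case/or3P=> /eqP ->; rewrite !inE !eqxx ?orbT.
Qed.

Lemma triangle_consistent x y z : distinct3 x y z ->
  consistent (triangle_clause x y z).
Proof.
case/and3P=> /negPf xy /negPf yz /negPf zx l; rewrite !in_triangle edge_neg.
have [yx zy xz] : [/\ y == x = false, z == y = false & x == z = false].
  by rewrite ![y == x]eq_sym [z == y]eq_sym [x == z]eq_sym.
by case/or3P=> /eqP -> /=; rewrite !xpair_eqE ?xy ?yz ?zx ?yx ?zy ?xz ?andbF.
Qed.

Lemma guard_notin_triangle x y z : distinct3 x y z ->
  ~~ decided (triangle_clause x y z) (guard x y z).
Proof.
move=> d; have [rs rsT _ _] := rs_guards d.
apply: contra rsT; rewrite /decided neg_lit // => H.
rewrite subUset !sub1set; apply/andP; have := @triangle_spans x y z.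
have sr : s x y z != r x y z by rewrite eq_sym.
by case/orP: H => H /(_ _ H); rewrite edge_lit //= => -[].
Qed.

(** As [F] holds false literals, [neg l \in F] says that [l] is true and the triangle satisfied. *)
Definition ready F L := [forall x, forall y, forall z, distinct3 x y z ==>
  [|| [exists l in triangle_clause x y z, neg l \in F],
      triangle_clause x y z \in L | decided F (guard x y z)]].

Lemma setT_of_card0 S : #|~: S| = 0 -> S = setT.
Proof. by move/eqP; rewrite cards_eq0 => /eqP E; rewrite -[S]setCK E setC0. Qed.

Lemma card_setCU1 S w : w \notin S -> #|~: S| = #|~: (w |: S)|.+1.
Proof.
move=> wS; by rewrite (cardsD1 w (~: S)) in_setC wS add1n setCU setIC setDE.
Qed.

Lemma solvable_full b Phi F S i L : 
  (forall L L' : {set clause (gtvar n)}, L \subset L' -> Phi L' <= Phi L) ->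
  source_of F S i -> GGT r s \subset L -> S = setT -> solvable b Phi 0 1 F L.
Proof.
move=> anti [_ _ _ iF] GL ST.
apply: (@solvable_good _ b Phi anti _ _ (Leaf (star i setT))) => //.
by split; [apply/(subsetP GL)/vertex_GGT|rewrite -ST].
Qed.

Lemma source_of_brute b Phi F S i L :
  (forall L L' : {set clause (gtvar n)}, L \subset L' -> Phi L' <= Phi L) ->
  source_of F S i -> GGT r s \subset L ->
  solvable b Phi 0 (brute_bound n K #|~: S|) F L.
Proof.
move=> anti; have [m Em] : {m | #|~: S| = m} by exists #|~: S|.
rewrite Em; elim: m S Em F i L => [|m IH] S Em F i L iF GL.
  apply: (solvable_le (c := 1)); first by rewrite /= /maxsize addn1.
  apply: solvable_full iF _ _ => //; exact: setT_of_card0.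
have /card_gt0P[w] : 0 < #|~: S| by rewrite Em.
rewrite inE => wS; have Em' : #|~: (w |: S)| = m.
  by have := card_setCU1 wS; rewrite Em => -[].
apply: (insert_unpaid (c := brute_bound n K m) rs_guards l0 anti GL iF wS).
  by elim: (m) => [|k IHk]; [exact: leqnn|apply: leq_trans IHk _ => /=; lia].
move=> i' F' L' _ _ LL' H; apply: IH Em' _ _ _ H _; exact: subset_trans LL'.
Qed.

(** The potential of the first phase, at most [n * n * n]; all triples are counted, degenerate ones
    included. *)
Definition unlearned L :=
  #|[set u : 'I_n * 'I_n * 'I_n | triangle_clause u.1.1 u.1.2 u.2 \notin L]|.

Lemma unlearned_anti L L' : L \subset L' -> unlearned L' <= unlearned L.
Proof.
move=> LL'; apply: subset_leq_card; apply/subsetP => u; rewrite !inE.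
exact/contra/(subsetP LL').
Qed.

Lemma unlearned_lt L L' x y z : L \subset L' -> triangle_clause x y z \notin L ->
  triangle_clause x y z \in L' -> unlearned L' < unlearned L.
Proof.
move=> LL' TL TL'; apply: proper_card; apply/properP; split.
  by apply/subsetP => u; rewrite !inE; exact/contra/(subsetP LL').
by exists (x, y, z); rewrite !inE ?TL //= negbK.
Qed.

Lemma consistentU (E F : {set literal (gtvar n)}) : consistent E -> consistent F ->
  (forall l, l \in E -> neg l \notin F) -> consistent (E :|: F).
Proof.
move=> cE cF EF l; rewrite !in_setU negb_or => /orP[lE|lF].
  by rewrite cE // EF.
rewrite cF // andbT; apply: contraL lF => /EF; by rewrite negK.
Qed.

Section Pay.
Variables (F : {set literal (gtvar n)}) (L : {set clause (gtvar n)}).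
Variables (S : {set 'I_n}) (i w y : 'I_n).
Hypothesis GL : GGT r s \subset L.
Hypothesis iF : source_of F S i.
Hypothesis wS : w \notin S.
Hypothesis yS : y \in S.
Hypothesis yi : y != i.
Let F2 := lit w y |: (lit i w |: F).

Lemma side_distinct : distinct3 i y w.
Proof.
case: iF => _ _ iS _.
rewrite /distinct3 eq_sym yi (contraNneq _ wS) => [|<- //].
by rewrite (contraNneq _ wS) // => ->.
Qed.

Lemma side_triangle : triangle_clause i y w \subset F2.
Proof.
apply/(triangle_subP l0); first exact: side_distinct.
have yiF : lit y i \in F by case: iF => _ _ _ /(starP l0); apply.
split; [exact/setU1r/setU1r|exact: setU11|exact/setU1r/setU11].
Qed.

Lemma side_consistent : consistent F2.
Proof.
have /and3P[_ yw wi] := side_distinct.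
have [iw wy] : i != w /\ w != y by split; rewrite eq_sym.
case: iF => cF sF iS _; apply: consistentU1; last first.
  rewrite neg_lit // in_setU1 negb_or lit_eq // (negPf yi) /=.
  by rewrite (spans_notin _ sF) // wS orbT.
by apply: consistentU1; rewrite // neg_lit // (spans_notin _ sF) // wS.
Qed.

Lemma side_arcs l : l \in F2 -> l \in F \/ (edge l).1 = w \/ (edge l).2 = w.
Proof.
have /and3P[_ yw wi] := side_distinct.
by rewrite !in_setU1 => /or3P[/eqP ->|/eqP ->|]; rewrite ?edge_lit 1?eq_sym //=;
  [right; left|right; right|left].
Qed.
(** [F2] closes the cycle [i], [y], [w]. If that triangle is neither learned nor has a decided
    guard, closing it learns it. Otherwise [F2] falsifies an available clause [C]; the triangle on
    [x], [y'], [z] is then derived under the larger set [T :|: F2], and [C] serves to weaken back to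
    [F2]. *)
Lemma side_pay x y' z : distinct3 x y' z ->
  w \notin [:: x; y'; z; r x y' z; s x y' z] ->
  (forall l, l \in triangle_clause x y' z -> neg l \notin F) ->
  triangle_clause x y' z \notin L -> ~~ decided F (guard x y' z) ->
  exists2 t, closing F2 L t & unlearned (L :|: learned t) < unlearned L.
Proof.
move=> d; rewrite !inE !negb_or => /and5P[wx wy' wz wr ws] TF TL gF.
have pay t : triangle_clause x y' z \in learned t ->
    unlearned (L :|: learned t) < unlearned L.
  by move=> H; apply: unlearned_lt TL _; [exact: subsetUl|rewrite in_setU H orbT].
have [H|H] :=
    boolP ((triangle_clause i y w \in L) || decided F2 (guard i y w)); last first.
  move: H; rewrite negb_or => /andP[T1L g1].
  have [t Ht Tt] := closing_guard rs_guards GL side_distinct side_triangle g1.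
  exists t => //; apply: unlearned_lt T1L _; first exact: subsetUl.
  by rewrite in_setU Tt orbT.
have [C CL] := guard_leaf rs_guards GL side_distinct H.
rewrite (setUidPl side_triangle) => CF2.
set T := triangle_clause x y' z in d TF TL gF pay *.
(* The literals of [F2] outside [F] touch [w], which occurs neither in the triangle nor in its
   guard, so they neither clash with [T] nor decide the guard. *)
have Tw l : l \in T -> (edge l).1 != w /\ (edge l).2 != w.
  move/triangle_spans; rewrite !inE -!orbA => -[].
  by case/or3P=> /eqP -> /or3P[] /eqP ->; rewrite ![_ == w]eq_sym.
have [rs _ _ _] := rs_guards d.
have [t Ht Tt] : exists2 t, closing (T :|: F2) L t & T \in learned t.
  apply: (closing_guard (l0 := l0) rs_guards GL d (subsetUl T F2)).
  move: gF (guard_notin_triangle d).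
  rewrite /decided !(in_setU _ T F2) !negb_or neg_lit //.
  move=> /andP[gF ngF] /andP[gT ngT].
  rewrite -/T in gT ngT; rewrite gT ngT /=.
  have sr : s x y' z != r x y' z by rewrite eq_sym.
  have F2E l : l \notin F -> (edge l).1 != w -> (edge l).2 != w -> l \notin F2.
    by move=> lF l1 l2; apply/negP => /side_arcs[|[]]; [exact/negP|exact/eqP|exact/eqP].
  by rewrite !F2E // edge_lit //= eq_sym.
have [|t' Ht' tt'] := closing_weaken _ Ht CL CF2; last first.
  by exists t' => //; apply/pay/(subsetP tt').
apply: consistentU; [exact: triangle_consistent|exact: side_consistent|].
move=> l lT; apply/negP => /side_arcs; rewrite edge_neg /=.
have [/eqP l1 /eqP l2] := Tw _ lT.
by case=> [|[]] //; apply/negP/TF.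
Qed.
End Pay.

End Phase1.

(** * Second phase: learning that vertices are not sources *)

Section Phase2.
Variables (n : nat) (r s : 'I_n -> 'I_n -> 'I_n -> 'I_n).
Hypothesis rs_guards : guards r s.
Variable l0 : literal (gtvar n).
Local Notation lit := (lit l0).
Local Notation guard := (guard r s l0).
Implicit Types (x y z w a i : 'I_n) (S : {set 'I_n}).
Implicit Types (E F H : {set literal (gtvar n)}) (L : {set clause (gtvar n)}).
Local Notation K := (maxsize (gtvar n)).

Lemma lit_var x y z : x != y -> x != z -> (lit x y).1 = (lit x z).1 -> y = z.
Proof.
move=> xy xz E; have : lit x z = lit x y \/ lit x z = neg (lit x y).
  move: E; rewrite /neg; case: (lit x y) (lit x z) => v [] [v' []] /= ->; by [left|right].
have yx : y != x by rewrite eq_sym.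
rewrite neg_lit // => -[] /(congr1 (@edge n)); rewrite !edge_lit //.
  by case.
by case=> /eqP; rewrite (negPf xy).
Qed.

Variables (F0 : {set literal (gtvar n)}) (S0 : {set 'I_n}) (i0 : 'I_n).
Variable L0 : {set clause (gtvar n)}.
Hypothesis GL0 : GGT r s \subset L0.
Hypothesis iF0 : source_of F0 S0 i0.
Hypothesis rdy : ready r s l0 F0 L0.

(** From the ready state [F0] on, a triangle not satisfied by [F0] acts as a clause: either it is
    learned or its guard is decided. *)
Lemma ready_leaf L x y z : L0 \subset L -> distinct3 x y z ->
  (forall l, l \in triangle_clause x y z -> neg l \notin F0) ->
  exists2 C, C \in L & C \subset F0 :|: triangle_clause x y z.
Proof.
move=> LL d TF; apply: (guard_leaf (l0 := l0) rs_guards (subset_trans GL0 LL) d).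
move/forallP/(_ x)/forallP/(_ y)/forallP/(_ z)/implyP/(_ d): rdy.
case/or3P=> [/exists_inP[l /TF H]|H|->]; [by rewrite (negPf H)| |by rewrite orbT].
by rewrite (subsetP LL).
Qed.

(** In [E], [w] points to [a] and [a] points to the rest of [S], so the triangle on [w], [a], [y]
    forces [w] to point to [y]. Thus [w] would be a source of [w |: S], which [D] denies up to [F0];
    the triangles are resolved against [D] one vertex at a time. *)
Lemma closing_cross E F L S a w D :
  E \subset F -> F0 \subset E -> consistent E -> L0 \subset L ->
  a \in S -> w \notin S -> w \notin S0 -> lit a w \in E -> star a S \subset E ->
  (forall y, y \in S -> y != a -> lit w y \notin F /\ lit y w \notin F) ->
  D \in L -> D \subset F0 :|: star w (w |: S) ->
  exists2 t, closing F L t & concl t \subset E.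
Proof.
move=> EF FE cE LL aS wS wS0 awE saE Hy DL sD.
have neq_w y : y \in S -> w != y by move=> yS; apply: contraNneq wS => ->.
have [_ sF0 _ _] := iF0.
pose ls := [seq lit w y | y <- enum (S :\ a)].
have lsP l : l \in ls -> exists y, [/\ y \in S, y != a & l = lit w y].
  by case/mapP=> y; rewrite mem_enum !inE => /andP[ya yS] ->; exists y.
apply: (@closing_comb _ ls E F L D) => //.
- rewrite -map_comp map_inj_in_uniq ?enum_uniq // => y y'.
  rewrite !mem_enum !inE => /andP[_ yS] /andP[_ y'S] /=.
  by apply: lit_var; apply: neq_w.
- move=> l /lsP[y [yS ya ->]]; rewrite neg_lit; [exact: Hy|exact: neq_w].
- move=> l /lsP[y [yS ya ->]]; have wy := neq_w _ yS; have wa := neq_w _ aS.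
  have [yw aw] : y != w /\ a != w by split; rewrite eq_sym.
  have yaE : lit y a \in E by apply: (starP l0 _ _ _ saE).
  have d : distinct3 w a y by rewrite /distinct3 wa eq_sym ya yw.
  (* [F0] does not satisfy this triangle: it decides no arc at [w], and [lit y a] is false in the
     consistent set [E], which contains [F0]. *)
  have [|B BL sB] := ready_leaf LL d.
    move=> l'; rewrite in_triangle => /or3P[] /eqP El.
    + have -> : neg l' = lit w a by apply/eqP; rewrite eq_lit // edge_neg El.
      by rewrite (spans_notin _ sF0) // wS0.
    + have -> : l' = lit y a by apply/eqP; rewrite eq_lit // El.
      by apply: contra (cE _ yaE); apply: (subsetP FE).
    + have -> : neg l' = lit y w by apply/eqP; rewrite eq_lit // edge_neg El.
      by rewrite (spans_notin _ sF0) // wS0 orbT.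
  exists B => //; apply: subset_trans sB _; rewrite subUset.
  rewrite (subset_trans FE (subsetUr _ _)) /=.
  by apply/(triangle_subP l0 _ d); split; [exact: setU1r|exact: setU1r|exact: setU11].
- move=> l /(subsetP sD); rewrite in_setU => /orP[/(subsetP FE) ->//|].
  rewrite inE => /andP[/eqP l2]; rewrite in_setU1 => /orP[/eqP l1|l1].
    by have := edge_neq l; rewrite l1 l2 eqxx.
  have El : l = lit (edge l).1 w.
    by apply/eqP; rewrite eq_lit -l2 ?edge_neq //; case: (edge l).
  have [la|la] := eqVneq (edge l).1 a; first by rewrite El la awE.
  apply/orP; right; rewrite El neg_lit; last by rewrite -l2 edge_neq.
  by apply: map_f; rewrite mem_enum !inE la l1.
Qed.

Let us := enum (~: S0).
Definition reach m : {set 'I_n} := S0 :|: [set x in take m us].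
Definition inserted m := nth i0 us m.
Let ur := size us.

Lemma inserted_notin m l : m <= l -> l < ur -> inserted l \notin reach m.
Proof.
move=> ml lr; have := mem_nth i0 lr; rewrite mem_enum in_setC -/(inserted l) => nS.
rewrite in_setU negb_or nS inE; apply/negP => /(nthP i0)[j].
rewrite size_takel; last exact: leq_trans ml (ltnW lr).
move=> jm; rewrite nth_take // => /eqP; rewrite nth_uniq ?enum_uniq //; last first.
  exact: leq_trans (leq_trans jm ml) (ltnW lr).
by move=> /eqP jl; move: jm; rewrite jl ltnNge ml.
Qed.

Lemma inserted_S0 l : l < ur -> inserted l \notin S0.
Proof. by move=> /(inserted_notin (leq0n l)); apply: contra => H; rewrite in_setU H. Qed.

Lemma reachS m : m < ur -> reach m.+1 = inserted m |: reach m.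
Proof.
move=> mr; rewrite /reach (take_nth i0) //; apply/setP=> x.
by rewrite !inE mem_rcons inE orbCA.
Qed.

Lemma reach_size : reach ur = setT.
Proof. by rewrite /reach take_size; apply/setP=> x; rewrite !inE mem_enum inE orbN. Qed.

Lemma inserted_in l m : l < m -> l < ur -> inserted l \in reach m.
Proof.
move=> lm lr; rewrite in_setU inE; apply/orP; right.
rewrite /inserted -(nth_take _ lm); apply: mem_nth; rewrite size_take.
by case: ifP.
Qed.

(* Up to literals false in [F0], some available clause states that [a] is not a
   source of [reach m]. *)
Definition av L a m := [exists D in L, D \subset F0 :|: star a (reach m)].

Lemma av_mono L L' a m : L \subset L' -> av L a m -> av L' a m.
Proof.
move=> LL' /exists_inP[D DL sD]; apply/exists_inP; exists D => //.
exact: (subsetP LL').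
Qed.

Lemma av_size L a : L0 \subset L -> av L a ur.
Proof.
move=> LL; apply/exists_inP; exists (star a setT); last by rewrite reach_size subsetUr.
exact/(subsetP LL)/(subsetP GL0)/vertex_GGT.
Qed.

(** The potential of the second phase, at most [n.+1 * n] whatever the number [ur] of remaining
    vertices. *)
Definition unavailable L :=
  #|[set u : 'I_n.+1 * 'I_n | ~~ av L u.2 u.1]|.

Lemma unavailable_anti L L' : L \subset L' -> unavailable L' <= unavailable L.
Proof.
move=> LL'; apply: subset_leq_card; apply/subsetP => u; rewrite !inE.
exact/contra/av_mono.
Qed.

Lemma ur_le : ur <= n.
Proof. by rewrite /ur /us -cardE -[X in _ <= X]card_ord max_card. Qed.

Lemma unavailable_lt L L' a m : L \subset L' -> m <= n -> ~~ av L a m ->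
  av L' a m -> unavailable L' < unavailable L.
Proof.
move=> LL' mn avL avL'; apply: proper_card; apply/properP; split.
  by apply/subsetP => u; rewrite !inE; exact/contra/av_mono.
have mn' : m < n.+1 by [].
by exists (Ordinal mn', a); rewrite !inE ?avL //= negbK.
Qed.

(** By [closing_cross], letting an inserted vertex point to [a] is refuted at once by a closing
    derivation. Hence [a] stays the source and the search does not fork. *)
Lemma chain b Phi m a F L :
  (forall L L' : {set clause (gtvar n)}, L \subset L' -> Phi L' <= Phi L) ->
  source_of F (reach m) a -> F0 \subset F -> L0 \subset L -> m <= ur ->
  (forall l, m <= l -> l < ur -> av L (inserted l) l.+1) ->
  solvable b Phi 0 (K + (ur - m) * K.+1) F L.
Proof.
move=> anti; have [k Ek] : {k | k = ur - m} by exists (ur - m).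
rewrite -Ek; elim: k m Ek F L => [|k IH] m Ek F L aF FF LL mr Hav.
  rewrite addn0; apply: (solvable_le (c := 1)); first by rewrite /maxsize addn1.
  apply: (solvable_full _ anti aF (subset_trans GL0 LL)).
  by have -> : m = ur; [by clear - Ek mr; lia|exact: reach_size].
have mr' : m < ur by clear - Ek; lia.
have mR := inserted_notin (leqnn m) mr'; set w := inserted m in mR.
have [cF sF aR staF] := aF.
have aw : a != w by apply: contraNneq mR => <-.
have wa : w != a by rewrite eq_sym.
have wF y : y \in reach m -> lit w y \notin F /\ lit y w \notin F.
  move=> yR; have wy : w != y by apply: contraNneq mR => ->.
  by split; rewrite (spans_notin _ sF) // ?mR ?orbT // eq_sym.
apply: solvable_open => [//||Ho]; first by apply: leq_addr.
have [_ awF] := wF _ aR.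
have [D DL sD] := exists_inP (Hav _ (leqnn m) mr').
have [t Ht _] : exists2 t, closing (lit a w |: F) L t & concl t \subset lit a w |: F.
  apply: (@closing_cross _ _ L (reach m) a w D) => //.
  - exact: subset_trans FF (subsetUr _ _).
  - by apply: consistentU1 => //; rewrite neg_lit //; case: (wF a aR).
  - exact: inserted_S0.
  - exact: setU11.
  - exact: subset_trans staF (subsetUr _ _).
  - move=> y yR ya; have [? ?] := wF y yR; have yw : y != w by apply: contraNneq mR => <-.
    have wy : w != y by rewrite eq_sym.
    by rewrite !(in_setU1 _ (lit a w)) !negb_or !lit_eq // (negPf wa) (negPf ya).
  - by rewrite -reachS.
have waF : lit w a \notin F by case: (wF a aR).
apply: (solvable_Res anti awF _ Ho (solvable_closing b anti Ht) (p2 := 0)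
  (c2 := K + k * K.+1)); first by rewrite neg_lit.
- move=> L' LL'; rewrite neg_lit //; apply: (IH m.+1) => //.
  + by clear - Ek; lia.
  + by rewrite reachS //; apply: source_of_insert.
  + exact: subset_trans FF (subsetUr _ _).
  + exact: subset_trans LL LL'.
  + by move=> l /ltnW ml lr; apply: av_mono LL' _; apply: Hav.
- by rewrite mulSn; move: K => q; clear; lia.
Qed.

Section Frontier.
Variables (F : {set literal (gtvar n)}) (L : {set clause (gtvar n)}).
Variables (m : nat) (i y : 'I_n).
Hypothesis mr : m < ur.
Hypothesis iF : source_of F (reach m) i.
Hypothesis FF : F0 \subset F.
Hypothesis LL : L0 \subset L.
Hypothesis yS : y \in reach m.
Hypothesis yi : y != i.
Let w := inserted m.
Let F2 := lit w y |: (lit i w |: F).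

(** As in [side_pay], the closed cycle under [F2] is the occasion to learn an unrelated clause, here
    one giving [av a j]. Choosing first [k] and then [j] maximal among the failures makes the two
    facts at [j.+1] that imply it available. *)
Lemma frontier_pay l : m < l < ur -> ~~ av L (inserted l) l.+1 ->
  exists2 t, closing F2 L t & unavailable (L :|: learned t) < unavailable L.
Proof.
move=> /andP[ml lr] avl; have GL := subset_trans GL0 LL.
have wR : w \notin reach m by apply: inserted_notin.
have [cF sF iS _] := iF.
pose P k := [&& m < k, k < ur & ~~ av L (inserted k) k.+1].
have exP : exists k, P k by exists l; rewrite /P ml lr avl.
have leP k : P k -> k <= ur by case/and3P=> _ /ltnW.
have [k /and3P[mk kr avk] maxk] := ex_maxnP exP leP.
set a := inserted k in avk.
pose Q j := [&& k < j, j < ur & ~~ av L a j].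
have exQ : exists j, Q j.
  (* [k.+1] differs from [ur], where the vertex clause makes every vertex available. *)
  exists k.+1; rewrite /Q avk ltnSn /= andbT ltn_neqAle kr andbT.
  by apply: contraNneq avk => ->; apply: av_size.
have leQ j : Q j -> j <= ur by case/and3P=> _ /ltnW.
have [j /and3P[kj jr avj] maxj] := ex_maxnP exQ leQ.
set w' := inserted j.
have avaj : av L a j.+1.
  apply: contraTT (ltnSn j) => H; rewrite -leqNgt.
  have [jr'|jr'] := ltnP j.+1 ur; first by apply: maxj; rewrite /Q jr' H ltnS (ltnW kj).
  have E : j.+1 = ur by apply/eqP; rewrite eqn_leq jr jr'.
  by rewrite E av_size in H.
(* Maximality of [k] applies because [j] is larger. *)
have avw' : av L w' j.+1.
  apply: contraTT (kj) => H; rewrite -leqNgt; apply: maxk.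
  by rewrite /P H jr (ltn_trans mk kj).
have [D1 D1L sD1] := exists_inP avaj.
have [D2 D2L sD2] := exists_inP avw'.
have aS0 : a \notin S0 by apply: inserted_S0.
have w'S0 : w' \notin S0 by apply: inserted_S0.
have aR : a \notin reach m.+1 by apply: inserted_notin.
have w'R : w' \notin reach m.+1 by apply: inserted_notin => //; apply: ltn_trans mk kj.
have w'Rj : w' \notin reach j by apply: inserted_notin.
have aRj : a \in reach j by apply: inserted_in.
have w'a : w' != a by apply: contraNneq w'Rj => ->.
have aw' : a != w' by rewrite eq_sym.
have cF2 : consistent F2 := side_consistent iF wR yS yi.
have FF2 : F0 \subset F2.
  by apply: subset_trans FF _; rewrite /F2 setUA subsetUr.
have sF2 : spans (reach m.+1) F2.
  have [yw wi] : y != w /\ w != i.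
    by split; [apply: contraNneq wR => <-|apply: contraNneq wR => ->].
  rewrite reachS // /F2; apply: spansU1; rewrite ?setU11 ?setU1r // 1?eq_sym //.
  apply: spansU1; rewrite ?setU11 ?setU1r // 1?eq_sym //.
  exact: spans_sub (subsetUr _ _) sF.
have [cF0 sF0 _ _] := iF0.
(* [E] makes [a] a source of [reach j]; any learned clause inside [E] is a witness of [av a j]. *)
pose E := F0 :|: star a (reach j).
have cE : consistent E.
  apply: consistentU => //.
    move=> l'; rewrite !inE edge_neg /= => /andP[/eqP <- _].
    by rewrite (negPf (edge_neq l')).
  move=> l' /sF0[l'1 _]; rewrite inE edge_neg /=.
  by apply: contraTN l'1 => /andP[/eqP -> _].
have cEF2 : consistent (E :|: F2).
  apply: consistentU => // l'; rewrite in_setU => /orP[/(subsetP FF2)|]; first exact: cF2.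
  rewrite inE => /andP[/eqP l'2 _]; apply/negP => /sF2[].
  by rewrite edge_neg /= l'2 (negPf aR).
have und z x : z != x -> (z == w') && (x != a) || (x == w') -> lit z x \notin E :|: F2.
  move=> zx H; have w'zx : (z == w') || (x == w').
    by case/orP: H => [/andP[->]|->]; rewrite ?orbT.
  have notin S' F' : spans S' F' -> w' \notin S' -> lit z x \notin F'.
    move=> sF' w'S'; rewrite (spans_notin _ sF') //.
    by case/orP: w'zx => /eqP ->; rewrite w'S' ?orbT.
  rewrite (in_setU _ E F2) /E (in_setU _ F0) !negb_or (notin _ _ sF0) //.
  rewrite (notin _ _ sF2) // inE edge_lit //= andbT negb_and.
  by case/orP: H => [/andP[_ ->]//|/eqP ->]; rewrite w'a.
have und' : lit w' a \notin E :|: F2.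
  rewrite (in_setU _ E F2) /E (in_setU _ F0) !negb_or.
  rewrite (spans_notin _ sF0) ?w'S0 // (spans_notin _ sF2) ?w'R //.
  by rewrite inE edge_lit //= (negPf w'Rj) andbF.
have [t2 Ht2 ct2] : exists2 t, closing (lit a w' |: (E :|: F2)) L t &
    concl t \subset lit a w' |: E.
  apply: (@closing_cross _ _ L (reach j) a w' D2) => //.
  - by apply: setUS; apply: subsetUl.
  - by apply: subset_trans (subsetUl _ _) (subsetUr _ _).
  - apply: consistentU1 => //; rewrite neg_lit //.
    by apply: contra und' => H; rewrite in_setU H.
  - exact: setU11.
  - by apply: subset_trans (subsetUr _ _) (subsetUr _ _).
  - move=> z zR za; have w'z : w' != z by apply: contraNneq w'Rj => ->.
    have zw' : z != w' by rewrite eq_sym.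
    rewrite !(in_setU1 _ (lit a w')) !negb_or !lit_eq // (negPf w'a) (negPf za) /=.
    by rewrite !und ?eqxx ?za ?orbT.
  - by rewrite -reachS.
have sD1' : D1 \subset lit w' a |: E.
  apply: subset_trans sD1 _; apply/subsetP => l'; rewrite in_setU => /orP[l'F|].
    by apply: setU1r; rewrite in_setU l'F.
  rewrite inE reachS // (in_setU1 _ (inserted j)) => /andP[/eqP l'2 /orP[/eqP l'1|l'1]].
    have -> : l' = lit w' a; last exact: setU11.
    by apply/eqP; rewrite eq_lit // [edge l']surjective_pairing l'1 l'2.
  by apply: setU1r; rewrite in_setU inE l'2 eqxx l'1 orbT.
(* If [a] points to [w'], it is a source of [reach j.+1] and [D1] is falsified; if [w'] points to
   [a], then [t2] closes by means of [D2]. *)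
pose t1 := Res (lit w' a) (Leaf D1) t2.
have Ht1 : closing (E :|: F2) L t1.
  apply: closing_Leaf_Res => //; rewrite ?neg_lit //.
    by apply: und => //; rewrite eqxx orbT.
  by apply: subset_trans sD1' _; apply: setUS; apply: subsetUl.
have ct1 : concl t1 \subset E by rewrite /= neg_lit // subUset !subDset sD1' ct2.
have [C CL CF2] : exists2 C, C \in L & C \subset F2.
  have d := side_distinct iF wR yS yi; have T2 := side_triangle l0 iF wR yS yi.
  have [|C CL sC] := ready_leaf LL d.
    move=> l' /(subsetP T2) /cF2; apply: contra; exact: (subsetP FF2).
  by exists C => //; apply: subset_trans sC _; rewrite subUset FF2.
have [t Ht tt] := closing_weaken cEF2 Ht1 CL CF2; exists t => //.
apply: (unavailable_lt (subsetUl _ _) _ avj).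
  exact: leq_trans (ltnW jr) ur_le.
apply/exists_inP; exists (concl t1) => //; rewrite in_setU; apply/orP; right.
by apply: (subsetP tt); apply: input_concl_learned; case: Ht1.
Qed.
End Frontier.

Lemma ready_solvable m i F L : source_of F (reach m) i -> F0 \subset F ->
  L0 \subset L -> 1 < #|reach m| -> m <= ur ->
  solvable (ready_cost n K) unavailable 0 (ready_base n K + (ur - m) * step_cost n K) F L.
Proof.
have [k Ek] : {k | k = ur - m} by exists (ur - m).
rewrite -Ek; elim: k m Ek i F L => [|k IH] m Ek i F L iF FF LL Rm mr.
  apply: (solvable_le (c := 1)); first by rewrite addn0.
  apply: (solvable_full _ unavailable_anti iF (subset_trans GL0 LL)).
  by have -> : m = ur; [by clear - Ek mr; lia|exact: reach_size].
have mr' : m < ur by clear - Ek; lia.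
have Ek' : k = ur - m.+1 by clear - Ek; lia.
have mR := inserted_notin (leqnn m) mr'.
have GL := subset_trans GL0 LL.
have [y yR yi] := other_member i Rm.
(* The inequality is strict: nothing is known about [inserted m], so both outcomes of its insertion
   are kept, and each continues as a chain from [m.+1]. *)
have [/forallP Hall|] := boolP [forall l : 'I_ur, (m < l) ==> av L (inserted l) l.+1].
  apply: (solvable_le (c := ready_base n K)); first exact: leq_addr.
  apply: (insert_unpaid (c := chain_cost n K) rs_guards l0 unavailable_anti GL iF mR).
    exact: leq_addr.
  move=> i' F' L' _ FF' LL' iF'; rewrite -reachS // in iF'.
  apply: (solvable_le (c := K + (ur - m.+1) * K.+1)).
    rewrite leq_add2l leq_mul2r; apply/orP; right.
    exact: leq_trans (leq_subr _ _) ur_le.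
  apply: (chain _ unavailable_anti iF') => //.
  - exact: subset_trans FF FF'.
  - exact: subset_trans LL LL'.
  - move=> l ml lr; apply: av_mono LL' _.
    exact: (implyP (Hall (Ordinal lr)) ml).
case/forallPn=> l; rewrite negb_imply => /andP[ml avl].
have mlr : m < l < ur by rewrite ml ltn_ord.
have kn : k.+1 <= n by rewrite Ek; exact: leq_trans (leq_subr _ _) ur_le.
apply: (solvable_le (c := (n.+1 * K.+1 + (ready_base n K + k * step_cost n K)).+1)).
  rewrite (mulSn k) /step_cost; move: (n.+1 * K.+1) => q; move: (k * q.+1) => q'.
  by clear; lia.
apply: (insert_paid rs_guards unavailable_anti GL iF mR _ _ yR yi _
  (frontier_pay mr' iF FF LL yR yi mlr avl)).
- rewrite /ready_base /chain_cost; move: (_ * K.+1) => ?; clear; lia.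
- move=> i' F' L' _ FF' LL' iF'; rewrite -reachS // in iF'.
  apply: (IH m.+1) iF' _ _ _ _ => //.
  + exact: subset_trans FF FF'.
  + exact: subset_trans LL LL'.
  + apply: leq_trans Rm _; apply: subset_leq_card; rewrite reachS //; exact: subsetUr.
- by rewrite leq_add2l leq_mul2r ltnW ?orbT.
Qed.

Lemma ready_tree : 1 < #|S0| -> exists2 t, good F0 L0 t &
  num_clauses t <= ready_cost n K * (n.+1 * n).+1.
Proof.
move=> S0gt.
have R0 : reach 0 = S0.
  by apply/setP=> x; rewrite /reach take0 !inE orbF.
have [||//|t Ht nt] := @ready_solvable 0 i0 F0 L0 _ (subxx _) (subxx _).
- by rewrite R0.
- by rewrite R0.
exists t => //; apply: leq_trans (leq_trans _ nt) _.
  by rewrite addn0 leq_addr.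
rewrite subn0 mulnS addnC leq_add //.
  by rewrite leq_add2l leq_mul2r ur_le orbT.
rewrite leq_mul2l; apply/orP; right.
by apply: leq_trans (max_card _) _; rewrite card_prod !card_ord.
Qed.

End Phase2.

(** * Assembling the two phases *)

Definition guarded_base (m K : nat) :=
  brute_bound m K 5 + ready_cost m K * (m.+1 * m).+1.

Definition guarded_cost (m K : nat) := guarded_base m K + m * step_cost m K.

Definition total_cost (m K : nat) :=
  guarded_cost m K * (m * m * m) + (guarded_cost m K + m * K.+1 + guarded_cost m K).+1.

Lemma brute_bound_ge m K u : K <= brute_bound m K u.
Proof. elim: u => [|u IH]; [exact: leqnn|apply: leq_trans IH _ => /=; lia]. Qed.

Lemma brute_bound_le m K u v : u <= v -> brute_bound m K u <= brute_bound m K v.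
Proof.
move=> /subnK <-; elim: (v - u) => [|d IH]; first exact: leqnn.
by apply: leq_trans IH _; rewrite addSn /=; lia.
Qed.

Section Phase1Main.
Variables (n : nat) (r s : 'I_n -> 'I_n -> 'I_n -> 'I_n).
Hypothesis rs_guards : guards r s.
Variable l0 : literal (gtvar n).
Implicit Types (i : 'I_n) (S : {set 'I_n}).
Implicit Types (F : {set literal (gtvar n)}) (L : {set clause (gtvar n)}).
Local Notation K := (maxsize (gtvar n)).

(** With at most five vertices missing, brute force suffices; in a ready state the second phase
    takes over; otherwise a triangle violating [ready] pays for the insertion of a vertex away from
    it. *)
Lemma guarded_solvable F S i L : source_of F S i -> GGT r s \subset L -> 1 < #|S| ->
  solvable (guarded_cost n K) (@unlearned n) 0
    (guarded_base n K + #|~: S| * step_cost n K) F L.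
Proof.
have [k Ek] : {k | #|~: S| = k} by exists #|~: S|.
rewrite Ek; elim: k S Ek i F L => [|k IH] S Ek i F L iF GL S1.
  apply: solvable_le (source_of_brute rs_guards l0 _ (@unlearned_anti n) iF GL).
  by rewrite Ek addn0 -[X in X <= _]addn0 leq_add // brute_bound_le.
have [u5|u5] := leqP k.+1 5.
  apply: solvable_le (source_of_brute rs_guards l0 _ (@unlearned_anti n) iF GL).
  rewrite Ek /guarded_base -!addnA; apply: leq_trans (leq_addr _ _).
  exact: brute_bound_le.
have [rdy|] := boolP (ready r s l0 F L).
  have [t Ht nt] := ready_tree rs_guards GL iF rdy S1.
  apply: (solvable_good _ (@unlearned_anti n) Ht); apply: leq_trans nt _.
  by apply: leq_trans (leq_addr _ _); apply: leq_addl.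
case/forallPn=> x /forallPn[y /forallPn[z]]; rewrite negb_imply => /andP[d].
rewrite 2!negb_or => /and3P[/exists_inPn TF TL gF].
(* A triangle and its guard involve at most five vertices and at least six are missing from [S];
   this explains the constant in [guarded_base]. *)
have [w wS wT] : exists2 w, w \in ~: S & w \notin [:: x; y; z; r x y z; s x y z].
  apply/subsetPn/negP => /subset_leq_card; rewrite Ek.
  move/leq_trans/(_ (card_size _)); rewrite leqNgt => /negP; apply; exact: u5.
rewrite inE in wS; have [j jS ji] := other_member i S1.
have Ek' : #|~: (w |: S)| = k by have := card_setCU1 wS; rewrite Ek => -[].
have kn : k.+1 <= n by rewrite -Ek -[X in _ <= X]card_ord max_card.
apply: (solvable_le (c := (n.+1 * K.+1 + (guarded_base n K + k * step_cost n K)).+1)).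
  rewrite (mulSn k) /step_cost; move: (n.+1 * K.+1) => q; move: (k * q.+1) => q'.
  by clear; lia.
apply: (insert_paid rs_guards (@unlearned_anti n) GL iF wS _ _ jS ji _
  (side_pay rs_guards GL iF wS jS ji d wT TF TL gF)).
- rewrite /guarded_base -!addnA; apply: leq_trans (leq_addr _ _).
  exact: brute_bound_ge.
- move=> i' F' L' _ FF' LL' iF'; apply: IH Ek' _ _ _ iF' _ _.
    exact: subset_trans GL LL'.
  apply: leq_trans S1 _; apply: subset_leq_card; exact: subsetUr.
- by rewrite leq_add2l leq_mul2r ltnW ?orbT.
Qed.

(** A paid insertion needs a second vertex in [S]. Starting from one vertex, the first insertion is
    therefore unpaid, whence the two extra copies of [guarded_cost] in [total_cost]. *)
Lemma GGT_tree : 1 < n -> exists2 t, good set0 (GGT r s) t &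
  num_clauses t <= total_cost n K.
Proof.
move=> n1; pose v := Ordinal (ltnW n1); pose w := Ordinal n1.
have wv : w \notin [set v] by rewrite inE -val_eqE.
have vF : source_of set0 [set v] v.
  split; rewrite ?set11 //; [by move=> l; rewrite inE|by move=> l; rewrite inE|].
  by apply/(starP l0) => y; rewrite inE => /eqP ->; rewrite eqxx.
have [|i F L _ _ GL iF|t Ht nt] := insert_unpaid (c := guarded_cost n K) rs_guards l0
  (b := guarded_cost n K) (@unlearned_anti n) (subxx _) vF wv.
- rewrite /guarded_cost /guarded_base -!addnA; apply: leq_trans (leq_addr _ _).
  exact: brute_bound_ge.
- have := guarded_solvable iF GL; rewrite cardsU1 cards1 wv => /(_ isT).
  apply: solvable_le; rewrite leq_add2l leq_mul2r; apply/orP; right.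
  by rewrite -[X in _ <= X]card_ord max_card.
exists t => //; apply: leq_trans (leq_trans _ nt) _; first by rewrite addn0 leq_addr.
rewrite leq_add2r leq_mul2l; apply/orP; right.
by apply: leq_trans (max_card _) _; rewrite !card_prod !card_ord.
Qed.
End Phase1Main.

(** * The cost is polynomial in the number of vertices *)

Lemma total_cost_le m K K' : K <= K' -> total_cost m K <= total_cost m K'.
Proof.
move=> KK'; have bb u : brute_bound m K u <= brute_bound m K' u.
  by elim: u => //= u IH; rewrite ltnS !leq_add // leq_mul.
have ss : step_cost m K <= step_cost m K' by rewrite ltnS leq_mul.
have cc : chain_cost m K <= chain_cost m K' by rewrite leq_add // leq_mul.
have gg : guarded_cost m K <= guarded_cost m K'.
  rewrite leq_add ?leq_mul // leq_add // leq_mul // leq_add ?leq_mul //.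
  by rewrite ltnS !leq_add // leq_mul.
apply: leq_add; first exact: leq_mul.
by rewrite ltnS; apply: leq_add => //; apply: leq_add => //; exact: leq_mul.
Qed.

Lemma maxsize_gtvar n : maxsize (gtvar n) <= 4 * (n * n) + 1.
Proof.
rewrite /maxsize leq_add2r card_prod card_bool.
suff : #|gtvar n| <= n * n by lia.
by rewrite card_sig; apply: leq_trans (max_card _) _; rewrite card_prod !card_ord.
Qed.

Import Order.TTheory GRing.Theory Num.Theory.
Local Open Scope ring_scope.

Definition is_polynomial (f : nat -> nat) :=
  exists p : {poly int}, forall n, (f n)%:Z = p.[n%:Z].

Lemma is_polynomial_const c : is_polynomial (fun _ => c).
Proof. by exists (c%:Z)%:P => n; rewrite hornerC. Qed.

Lemma is_polynomial_id : is_polynomial id.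
Proof. by exists 'X => n; rewrite hornerX. Qed.

Lemma is_polynomialD f g : is_polynomial f -> is_polynomial g ->
  is_polynomial (fun n => f n + g n)%N.
Proof. by move=> [p Hp] [q Hq]; exists (p + q) => n; rewrite PoszD Hp Hq hornerD. Qed.

Lemma is_polynomialM f g : is_polynomial f -> is_polynomial g ->
  is_polynomial (fun n => f n * g n)%N.
Proof. by move=> [p Hp] [q Hq]; exists (p * q) => n; rewrite PoszM Hp Hq hornerM. Qed.

Lemma is_polynomialS f : is_polynomial f -> is_polynomial (fun n => (f n).+1).
Proof.
move=> [p Hp]; exists (p + 1) => n.
by rewrite -addn1 PoszD Hp hornerD hornerC.
Qed.

Lemma is_polynomial_total_cost :
  is_polynomial (fun n => total_cost n (4 * (n * n) + 1)).
Proof.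
have hid := is_polynomial_id.
pose K n := (4 * (n * n) + 1)%N.
have hK : is_polynomial K.
  apply: is_polynomialD (is_polynomial_const 1).
  by apply: is_polynomialM (is_polynomial_const 4) _; apply: is_polynomialM.
have hnK : is_polynomial (fun n => n * (K n).+1)%N by apply/is_polynomialM/is_polynomialS.
(* Polynomial in [n] for each fixed [u]; [total_cost] uses the constant [u = 5]. *)
have hbrute u : is_polynomial (fun n => brute_bound n (K n) u).
  elim: u => //= u IH; apply/is_polynomialS/is_polynomialD => //.
  exact: is_polynomialD.
have hstep : is_polynomial (fun n => step_cost n (K n)).
  by apply/is_polynomialS/is_polynomialM; apply: is_polynomialS.
have hnstep : is_polynomial (fun n => n * step_cost n (K n))%N by apply: is_polynomialM.
have hchain : is_polynomial (fun n => chain_cost n (K n)) by apply: is_polynomialD.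
have hready : is_polynomial (fun n => ready_cost n (K n)).
  apply: is_polynomialD => //; apply: is_polynomialS; apply: is_polynomialD => //.
  exact: is_polynomialD.
have hguarded : is_polynomial (fun n => guarded_cost n (K n)).
  apply: is_polynomialD => //; apply: is_polynomialD; first exact: hbrute.
  apply: is_polynomialM => //; apply: is_polynomialS.
  by apply: is_polynomialM => //; apply: is_polynomialS.
apply: is_polynomialD.
  by apply: is_polynomialM => //; apply: is_polynomialM => //; apply: is_polynomialM.
by apply: is_polynomialS; apply: is_polynomialD => //; apply: is_polynomialD.
Qed.

Theorem theorem4 :
  exists p : {poly int},
    forall (n : nat) (r s : 'I_n -> 'I_n -> 'I_n -> 'I_n),
      (2 <= n)%N -> guards r s ->
      exists R : wtree (gtvar n),
        [/\ regWRTI_refutation (GGT r s) R,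
            greedy_unit_propagating (GGT r s) R &
            (num_clauses R)%:Z <= p.[n%:Z]].
Proof.
have [p Hp] := is_polynomial_total_cost; exists p => n r s n1 rs.
(* The arc between the vertices 0 and 1, as the default value that [lit] takes on equal vertices. *)
pose l0 : literal (gtvar n) := (exist _ (Ordinal (ltnW n1), Ordinal n1) isT, true).
have [R HR sR] := GGT_tree rs l0 n1.
have [R1 R2] := good_refutation HR; exists R; split=> //.
rewrite -Hp lez_nat; apply: leq_trans sR _.
exact: total_cost_le (maxsize_gtvar n).
Qed.
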